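(* Let $\mathbf{k}$ be a field, $q\in\mathbf{k}$, and $n,k\ge0$. Then all eigenvalues of $\mathcal{R}_{n,k}$ acting on $\mathcal{H}_n$ by right multiplication (or acting on a Specht module $S^\lambda$, $\lambda\vdash n$) are polynomials in $q$ with nonnegative integer coefficients; that is, the characteristic polynomial factors as $\prod_i (x-p_i(q))$ with each $p_i\in\mathbb{Z}_{\ge0}[t]$.
   Context: $\mathcal{H}_n$ is the Hecke algebra over $\mathbf{k}$ with parameter $q$: generated by $T_1,\dots,T_{n-1}$ with $T_i^2=(q-1)T_i+q$, $T_iT_j=T_jT_i$ for $|i-j|>1$, $T_iT_{i+1}T_i=T_{i+1}T_iT_{i+1}$; basis $(T_w)_{w\in S_n}$. $[k]_q=1+\cdots+q^{k-1}$, $[k]!_q=[1]_q\cdots[k]_q$. For an integer $m$, $\mathcal{B}_m=\sum_{i=1}^mT_{m-1}\cdots T_i$, $\mathcal{B}^*_m=\sum_{i=1}^mT_i\cdots T_{m-1}$ ($0$ if $m\le0$); $\mathcal{B}_{n,k}=\mathcal{B}_{n-k+1}\cdots\mathcal{B}_n$, $\mathcal{B}^*_{n,k}=\mathcal{B}^*_n\cdots\mathcal{B}^*_{n-k+1}$; $\mathcal{R}_{n,k}=\frac1{[k]!_q}\mathcal{B}^*_{n,k}\mathcal{B}_{n,k}$ (for specific $q$ defined by specializing the element computed for indeterminate $q$). $S^\lambda$ denotes the (right) Dipper–James Specht module of $\mathcal{H}_n$ indexed by $\lambda$, which has a basis defined uniformly in $q$. *)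

(* Defs.v *)
From HB Require Import structures.
From mathcomp Require Import all_boot all_order all_fingroup all_algebra.
From mathcomp Require Import zify.

Set Implicit Arguments.
Unset Strict Implicit.
Unset Printing Implicit Defensive.

Import GRing.Theory.
Local Open Scope ring_scope.

Section SymmetricGroup.
Local Open Scope group_scope.
Variable n : nat.
Implicit Types (w : 'S_n) (i j : nat) (x y a b : 'I_n).

(* s_i swaps the i-th and (i+1)-st letters (1-based), that is, the ordinals
   i-1 and i; it is the identity unless 0 < i < n. *)
Definition sp i : 'S_n :=
  if insub i.-1 is Some a then if insub i is Some b then tperm a b else 1%g
  else 1%g.

Definition inversions w : {set 'I_n * 'I_n} :=
  [set p : 'I_n * 'I_n | (p.1 < p.2)%N && (w p.2 < w p.1)%N].

Definition plen w : nat := #|inversions w|.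

Lemma sE i a b : a.+1 = b :> nat -> b = i :> nat -> sp i = tperm a b.
Proof.
move=> ab bi; rewrite /sp -bi -ab /= valK /=.
by have -> : insub a.+1 = Some b by rewrite ab valK.
Qed.

Lemma s_out i : ~~ ((0 < i)%N && (i < n)%N) -> sp i = 1%g.
Proof.
move=> Hi; rewrite /sp; case: insubP => // a _ ea; case: insubP => // b _ eb.
have -> : b = a by apply: val_inj; have := ltn_ord b; move: Hi ea eb => /=; lia.
by rewrite tperm1.
Qed.

Lemma s_inP i : (0 < i)%N && (i < n)%N ->
  exists a b, [/\ a.+1 = b :> nat, b = i :> nat & sp i = tperm a b].
Proof.
move=> /andP[i0 ilt]; have i1lt : (i.-1 < n)%N by lia.
have ab : (Ordinal i1lt).+1 = Ordinal ilt :> nat by rewrite /=; lia.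
by exists (Ordinal i1lt), (Ordinal ilt); split => //; apply: sE.
Qed.

Lemma sK i : (sp i * sp i = 1)%g.
Proof.
have [/s_inP[a [b [_ _ ->]]]|/s_out->] := boolP ((0 < i)%N && (i < n)%N).
  exact: tperm2.
by rewrite mulg1.
Qed.

Lemma sV i : ((sp i)^-1 = sp i)%g.
Proof. by apply/eqP; rewrite eq_invg_mul sK. Qed.

Lemma len1 : plen 1 = 0%N.
Proof.
apply/eqP; rewrite cards_eq0; apply/eqP/setP => p; rewrite !inE !perm1; lia.
Qed.

Lemma lenV w : plen w^-1 = plen w.
Proof.
rewrite /plen -(card_imset (inversions w) (f := fun p => (w p.2, w p.1))); last first.
  by move=> [x y] [x' y'] [/perm_inj-> /perm_inj->].
apply: eq_card => -[x y]; apply/idP/imsetP.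
  rewrite inE /= => /andP[h1 h2]; exists (w^-1 y, w^-1 x)%g; last by rewrite /= !permKV.
  by rewrite inE /= !permKV h1 h2.
by case=> -[x' y']; rewrite !inE /= => /andP[h1 h2] [-> ->]; rewrite !permK h1 h2.
Qed.

Lemma tperm_lt a b x y : a.+1 = b :> nat -> x != y ->
  ~~ ((x == a) && (y == b)) -> ~~ ((x == b) && (y == a)) ->
  (tperm a b x < tperm a b y)%N = (x < y)%N.
Proof.
move=> ab; rewrite -!val_eqE /= => xy h1 h2.
by case: tpermP => [e|e|/eqP xa /eqP xb]; case: tpermP => [e'|e'|/eqP ya /eqP yb];
  move: xy h1 h2; try move: xa xb; try move: ya yb; rewrite -?val_eqE /=; try (move/(congr1 val): e => /= e); try (move/(congr1 val): e' => /= e'); lia.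
Qed.

Lemma len_sl a b w : a.+1 = b :> nat -> (w a < w b)%N ->
  plen (tperm a b * w) = (plen w).+1.
Proof.
move=> ab wab; pose t := tperm a b.
have altb : (a < b)%N by lia.
have e : inversions (t * w) = (a, b) |: [set (t p.1, t p.2) | p in inversions w].
  apply/setP => -[x y]; rewrite !inE /= !permM.
  have [[-> ->]|nab] /= := altP ((x, y) =P (a, b)).
    by rewrite tpermL tpermR altb wab.
  apply/idP/imsetP.
    move=> /andP[xy wyx]; exists (t x, t y); last by rewrite /= !tpermK.
    rewrite inE /= wyx andbT tperm_lt //; try by rewrite -!val_eqE /=; lia.
  case=> -[x' y']; rewrite inE /= => /andP[xy' wyx'] [-> ->].
  rewrite !tpermK wyx' andbT tperm_lt //; try by rewrite -!val_eqE /=; lia.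
  by apply/negP => /andP[/eqP ex /eqP ey]; rewrite ex ey in wyx'; lia.
rewrite /plen e cardsU1 card_imset; last first.
  by move=> [x y] [x' y'] [/perm_inj-> /perm_inj->].
suff -> : (a, b) \notin [set (t p.1, t p.2) | p in inversions w] by [].
apply/negP => /imsetP[[x y]]; rewrite inE /= => /andP[xy _] [ea eb].
have ex : x = b by rewrite -[x](tpermK a b) -/t -ea /t tpermL.
have ey : y = a by rewrite -[y](tpermK a b) -/t -eb /t tpermR.
by rewrite ex ey in xy; lia.
Qed.

Lemma lt_len_sl a b i w : a.+1 = b :> nat -> b = i :> nat ->
  (plen w < plen (sp i * w))%N = (w a < w b)%N.
Proof.
move=> ab bi; rewrite (sE ab bi); have [lt|ge] := ltnP (w a) (w b).
  by rewrite len_sl // ltnS leqnn.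
have lt : (w b < w a)%N.
  rewrite ltn_neqAle ge andbT; apply/negP => /eqP/val_inj/perm_inj e.
  by move: ab; rewrite e; lia.
have := @len_sl a b (tperm a b * w) ab; rewrite mulgA tperm2 mul1g !permM tpermL tpermR.
by move=> ->//; rewrite ltnNge leqnSn.
Qed.

Lemma lt_len_sr a b i w : a.+1 = b :> nat -> b = i :> nat ->
  (plen w < plen (w * sp i))%N = (w^-1 a < w^-1 b)%N.
Proof.
move=> ab bi; rewrite -lenV -[plen (w * _)]lenV invMg sV.
exact: lt_len_sl.
Qed.

Lemma len_sr_desc i w : (plen (w * sp i) <= plen w)%N -> (0 < i)%N && (i < n)%N ->
  plen w = (plen (w * sp i)).+1.
Proof.
move=> le /s_inP[a [b [ab bi e]]].
have lt : (w^-1 b < w^-1 a)%N.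
  have := lt_len_sr w ab bi; rewrite ltnNge le /= => /esym/negbT; rewrite -leqNgt.
  rewrite leq_eqVlt => /orP[/eqP/val_inj/perm_inj eba|//]; move: ab; rewrite eba; lia.
rewrite -[plen w]lenV -[plen (w * _)]lenV invMg sV e -(len_sl ab) ?mulgA ?tperm2 ?mul1g //.
by rewrite !permM tpermL tpermR.
Qed.

Lemma len_sr_asc i w : (plen w < plen (w * sp i))%N -> plen (w * sp i) = (plen w).+1.
Proof.
have [vi|/s_out->] := boolP ((0 < i)%N && (i < n)%N); last by rewrite mulg1 ltnn.
move=> lt; have := @len_sr_desc i (w * sp i); rewrite -mulgA sK mulg1.
by apply => //; apply: ltnW.
Qed.

Lemma lt_mono_perm w : (forall a b, a.+1 = b :> nat -> (w a < w b)%N) -> w = 1%g.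
Proof.
move=> H.
have le x : (x <= w x)%N.
  case: x => m; elim: m => // m IH lt /=.
  have lt' : (m < n)%N by lia.
  apply: leq_ltn_trans (IH lt') _; exact: H.
have ge k : forall x, (n - x = k.+1)%N -> (w x <= x)%N.
  elim: k => [|k IH] x kx; first by have := ltn_ord (w x); lia.
  have lt' : (x.+1 < n)%N by lia.
  by have := IH (Ordinal lt') _; have := H x (Ordinal lt') erefl; rewrite /=; lia.
apply/permP => x; rewrite perm1; apply/val_inj/eqP; rewrite eqn_leq le andbT.
by apply: (ge (n - x).-1); have := ltn_ord x; lia.
Qed.

Lemma ex_descl w : w != 1%g ->
  exists2 i, (0 < i)%N && (i < n)%N & (plen (sp i * w) < plen w)%N.
Proof.
move=> w1; have [/existsP[a /existsP[b /andP[/eqP ab lt]]]|/existsPn H] :=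
  boolP [exists a : 'I_n, exists b : 'I_n, (a.+1 == b) && (w b < w a)%N].
  exists b; first by have := ltn_ord b; lia.
  have := @lt_len_sl a b b (sp b * w) ab erefl; rewrite mulgA sK mul1g => ->.
  by rewrite (sE ab erefl) !permM tpermL tpermR.
case/eqP: w1; apply: lt_mono_perm => a b ab.
have /existsPn/(_ b) := H a; rewrite ab eqxx /= -leqNgt leq_eqVlt => /orP[|//].
by move=> /eqP/val_inj/perm_inj e; move: ab; rewrite e; lia.
Qed.

Lemma ex_descr w : w != 1%g ->
  exists2 i, (0 < i)%N && (i < n)%N & (plen (w * sp i) < plen w)%N.
Proof.
rewrite -eq_invg1 => /ex_descl[i vi lt]; exists i => //.
by rewrite -lenV -[plen w]lenV invMg sV.
Qed.

Fixpoint redword_rec (m : nat) w : seq nat :=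
  if m is m'.+1 then
    if [pick i : 'I_n | (plen (w * sp i) < plen w)%N] is Some i
    then rcons (redword_rec m' (w * sp i)) i else [::]
  else [::].

(* a chosen reduced word i_1 ... i_l of w = s_(i_1) * ... * s_(i_l) *)
Definition redword w : seq nat := redword_rec (plen w) w.

End SymmetricGroup.
Arguments sp {n} i.

(* The Hecke algebra H_n with parameter q over R: the free R-module on
   (T_w)_(w in S_n), an element being the family of its coordinates. *)
Definition hecke (R : comNzRingType) (n : nat) (q : R) : Type :=
  {ffun 'S_n -> R^o}.

HB.instance Definition _ (R : comNzRingType) (n : nat) (q : R) :=
  GRing.Lmodule.copy (hecke n q) {ffun 'S_n -> R^o}.

Section HeckeProduct.
Variables (R : comNzRingType) (n : nat) (q : R).
Local Notation H := (hecke n q).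
Implicit Types (w u : 'S_n) (x y z h : H) (i j : nat) (f g : 'S_n -> H).

Definition coefT h w : R := (h : {ffun 'S_n -> R}) w.

Definition T w : H := [ffun u : 'S_n => (u == w)%:R : R^o].

Definition lin_ext f x : H := \sum_w coefT x w *: f w.

(* T_w |-> T_w T_i *)
Definition mulTi i w : H :=
  if (plen w < plen (w * sp i)%g)%N then T (w * sp i)%g
  else (q - 1) *: T w + q *: T (w * sp i)%g.

(* x T_w is obtained from x by multiplying it on the right by T_(i_1), ...,
   T_(i_l) in turn, where s_(i_1) ... s_(i_l) is a reduced word of w. *)
Definition mulTw x w : H := foldl (fun v i => lin_ext (mulTi i) v) x (redword w).

Definition hecke_mul x y : H := lin_ext (mulTw x) y.

Lemma coefTE w u : coefT (T w) u = (u == w)%:R.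
Proof. by rewrite /coefT /T ffunE. Qed.

Lemma coefT_eq x y : (forall w, coefT x w = coefT y w) -> x = y.
Proof. by move=> e; apply/ffunP => w; apply: e. Qed.

Lemma coefT_linear a x y w : coefT (a *: x + y) w = a * coefT x w + coefT y w.
Proof. by rewrite /coefT !ffunE. Qed.

Lemma coefT_sum w (I : Type) (r : seq I) (P : pred I) (F : I -> H) :
  coefT (\sum_(i <- r | P i) F i) w = \sum_(i <- r | P i) coefT (F i) w.
Proof. by rewrite /coefT sum_ffunE. Qed.

Lemma coefTZ a x w : coefT (a *: x) w = a * coefT x w.
Proof. by rewrite /coefT !ffunE. Qed.

Lemma hecke_sumT x : x = \sum_w coefT x w *: T w.
Proof.
apply: coefT_eq => u; rewrite coefT_sum (bigD1 u) //= coefTZ coefTE eqxx mulr1.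
rewrite big1 ?addr0 // => w wu.
by rewrite coefTZ coefTE eq_sym (negPf wu) mulr0.
Qed.

Fact lin_ext_is_linear f : linear (lin_ext f).
Proof.
move=> a x y; rewrite /lin_ext scaler_sumr -big_split; apply: eq_bigr => w _.
by rewrite coefT_linear scalerDl scalerA.
Qed.
HB.instance Definition _ f := GRing.isLinear.Build R H H _ (lin_ext f) (lin_ext_is_linear f).

Lemma lin_extT f w : lin_ext f (T w) = f w.
Proof.
rewrite /lin_ext (bigD1 w) //= coefTE eqxx scale1r big1 ?addr0 // => u uw.
by rewrite coefTE (negPf uw) scale0r.
Qed.

Let mulL i w : H :=
  if (plen w < plen (sp i * w)%g)%N then T (sp i * w)%g
  else (q - 1) *: T w + q *: T (sp i * w)%g.

Local Notation Rop i := (lin_ext (mulTi i)).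
Local Notation Lop i := (lin_ext (mulL i)).

Lemma lin_ext_comp (P Q : {linear H -> H}) :
  (forall w, P (T w) = Q (T w)) -> P =1 Q.
Proof.
move=> e x; rewrite (hecke_sumT x) !linear_sum; apply: eq_bigr => w _.
by rewrite !linearZ e.
Qed.

Let valid i := (0 < i)%N && (i < n)%N.

Let Lop_Rop_T i j w : valid i -> valid j ->
  Lop j (Rop i (T w)) = Rop i (Lop j (T w)).
Proof.
move=> /s_inP[a [b [ab bi ei]]] /s_inP[c [d [cd dj ej]]].
rewrite !lin_extT /mulTi /mulL.
have [E|NE] := eqVneq (sp j * w)%g (w * sp i)%g.
  have E' : (sp j * (w * sp i) = w)%g by rewrite -E mulgA sK mul1g.
  rewrite E; case: ifP => lt.
    by rewrite !lin_extT /mulTi /mulL E' -mulgA sK mulg1 [(_ < plen w)%N]ltnNge (ltnW lt).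
  by rewrite !linearD !linearZ /= !lin_extT /mulTi /mulL E' E lt -mulgA sK mulg1.
have eR : (plen (sp j * w) < plen (sp j * w * sp i))%g%N = (plen w < plen (w * sp i)%g)%N.
  rewrite !(lt_len_sr _ ab bi) invMg sV !permM ej.
  apply: tperm_lt => //.
  - by rewrite (inj_eq perm_inj); apply/eqP => e; move: ab; rewrite e; lia.
  - apply: contra NE => /andP[/eqP ea /eqP eb]; apply/eqP; rewrite ei ej.
    have -> : a = w c by rewrite -ea permKV.
    have -> : b = w d by rewrite -eb permKV.
    by rewrite -tpermJ conjgE mulgA mulgA mulgV mul1g.
  - apply: contra NE => /andP[/eqP ea /eqP eb]; apply/eqP; rewrite ei ej.
    have -> : a = w d by rewrite -ea permKV.
    have -> : b = w c by rewrite -eb permKV.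
    by rewrite -tpermJ conjgE mulgA mulgA mulgV mul1g tpermC.
have eL : (plen (w * sp i) < plen (sp j * (w * sp i)))%g%N = (plen w < plen (sp j * w)%g)%N.
  rewrite !(lt_len_sl _ cd dj) !permM ei.
  apply: tperm_lt => //.
  - by rewrite (inj_eq perm_inj); apply/eqP => e; move: cd; rewrite e; lia.
  - apply: contra NE => /andP[/eqP ea /eqP eb]; apply/eqP; rewrite ei ej.
    by rewrite -ea -eb -tpermJ conjgE mulgA mulgA mulgV mul1g.
  - apply: contra NE => /andP[/eqP ea /eqP eb]; apply/eqP; rewrite ei ej.
    by rewrite -ea -eb -tpermJ conjgE mulgA mulgA mulgV mul1g tpermC.
have eR' := eR; have eL' := eL.
case: ifP eR eL => ltR eR eL; case: ifP eL => ltL eL;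
  rewrite ?(linearD, linearZ) /= !lin_extT /mulTi /mulL ?eR' ?eL' ?ltR ?ltL ?mulgA //.
rewrite !scalerDr !addrA !scalerA [q * (q - 1)]mulrC; congr (_ + _).
exact: addrAC.
Qed.

Let Lop_Rop i j x : valid i -> valid j -> Lop j (Rop i x) = Rop i (Lop j x).
Proof.
move=> vi vj.
exact: (@lin_ext_comp (Lop j \o Rop i) (Rop i \o Lop j)) (fun w => Lop_Rop_T w vi vj) x.
Qed.

Let commL (P : H -> H) := forall j x, valid j -> Lop j (P x) = P (Lop j x).

Let commL_eq (P Q : {linear H -> H}) : commL P -> commL Q ->
  P (T 1%g) = Q (T 1%g) -> P =1 Q.
Proof.
move=> cP cQ e1; apply: lin_ext_comp => w.
have [m] := ubnP (plen w); elim: m w => // m IH w; rewrite ltnS => wm.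
have [->//|w1] := eqVneq w 1%g; have [i vi lt] := ex_descl w1.
have -> : T w = Lop i (T (sp i * w)%g).
  by rewrite lin_extT /mulL mulgA sK mul1g lt.
by rewrite -cP // -cQ // IH // (leq_trans lt).
Qed.

Lemma redwordP w :
  redword w = [::] /\ w = 1%g \/
  exists i : nat, [/\ valid i, (plen (w * sp i)%g < plen w)%N &
                      redword w = rcons (redword (w * sp i)%g) i].
Proof.
have [->|w1] := eqVneq w 1%g; first by left; rewrite /redword len1.
right; have [i0 vi0 lt0] := ex_descr w1; rewrite /redword.
case ew: (plen w) (lt0) => [|m] //= _; case: pickP => [i lt|none]; last first.
  by have /andP[_ i0n] := vi0; have := none (Ordinal i0n); rewrite /= lt0.
have vi : valid i.
  by apply: contraTT lt => /s_out ->; rewrite mulg1 ltnn.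
exists i; split => //; first by rewrite -ew.
by have := len_sr_desc (ltnW lt) vi; rewrite ew => -[->].
Qed.

Lemma redword_ind (P : 'S_n -> Prop) : P 1%g ->
  (forall w i, valid i -> (plen (w * sp i)%g < plen w)%N ->
     redword w = rcons (redword (w * sp i)%g) i -> P (w * sp i)%g -> P w) ->
  forall w, P w.
Proof.
move=> P1 PS w; have [m] := ubnP (plen w); elim: m w => // m IH w; rewrite ltnS => wm.
have [[_ ->]//|[i [vi lt e]]] := redwordP w.
by apply: (PS w i) => //; apply: IH; apply: leq_trans lt wm.
Qed.

Let mulTw1 x : mulTw x 1%g = x.
Proof. by rewrite /mulTw /redword len1. Qed.

Let mulTwS x w i : redword w = rcons (redword (w * sp i)%g) i ->
  mulTw x w = Rop i (mulTw x (w * sp i)%g).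
Proof. by rewrite /mulTw => ->; rewrite foldl_rcons. Qed.

Fact mulTw_is_linear w : linear (mulTw^~ w).
Proof.
elim/redword_ind: w => [|w i vi lt e IH] a x y; first by rewrite !mulTw1.
by rewrite !(mulTwS _ e) IH linearP.
Qed.

Lemma mulTw_T1 w : mulTw (T 1%g) w = T w.
Proof.
elim/redword_ind: w => [|w i vi lt e IH]; first exact: mulTw1.
by rewrite (mulTwS _ e) IH lin_extT /mulTi -mulgA sK mulg1 lt.
Qed.

Let hecke_mulr y x := hecke_mul x y.

Fact hecke_mul_is_linear y : linear (hecke_mulr y).
Proof.
move=> a x x'; rewrite /hecke_mulr /hecke_mul /lin_ext scaler_sumr -big_split.
by apply: eq_bigr => w _; rewrite mulTw_is_linear scalerDr !scalerA mulrC.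
Qed.
HB.instance Definition _ y :=
  GRing.isLinear.Build R H H _ (hecke_mulr y) (hecke_mul_is_linear y).
HB.instance Definition _ x :=
  GRing.isLinear.Build R H H _ (hecke_mul x) (lin_ext_is_linear (mulTw x)).

Let commL_mul y : commL (hecke_mulr y).
Proof.
move=> j x vj; rewrite /hecke_mulr /hecke_mul /= /lin_ext -/(lin_ext _ _) linear_sum.
apply: eq_bigr => w _; rewrite linearZ /=; congr (_ *: _).
elim/redword_ind: w => [|w i vi lt e IH]; first by rewrite !mulTw1.
by rewrite !(mulTwS _ e) Lop_Rop // IH.
Qed.

Lemma hecke_mul1l : left_id (T 1%g) hecke_mul.
Proof.
move=> y; rewrite /hecke_mul {2}(hecke_sumT y); apply: eq_bigr => w _.
by rewrite mulTw_T1.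
Qed.

Lemma hecke_mul1r : right_id (T 1%g) hecke_mul.
Proof. by move=> x; rewrite /hecke_mul lin_extT mulTw1. Qed.

Lemma hecke_mulA : associative hecke_mul.
Proof.
move=> x y z.
pose P : {linear H -> H} := hecke_mulr (hecke_mul y z).
pose Q : {linear H -> H} := hecke_mulr z \o hecke_mulr y.
suff : P =1 Q by apply.
apply: commL_eq => /=.
- exact: commL_mul.
- by move=> j u vj; rewrite /= !commL_mul.
- by rewrite /hecke_mulr /= !hecke_mul1l.
Qed.

Lemma hecke_mulDl : left_distributive hecke_mul +%R.
Proof. by move=> x y z; exact: (linearD (hecke_mulr z)). Qed.

Lemma hecke_mulDr : right_distributive hecke_mul +%R.
Proof. by move=> x y z; exact: (linearD (hecke_mul x)). Qed.

Lemma hecke_1_neq0 : T 1%g != 0.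
Proof.
apply/eqP => /(congr1 (coefT^~ 1%g))/eqP; rewrite coefTE eqxx /coefT ffunE.
by rewrite oner_eq0.
Qed.

HB.instance Definition _ := GRing.Zmodule_isNzRing.Build H
  hecke_mulA hecke_mul1l hecke_mul1r hecke_mulDl hecke_mulDr hecke_1_neq0.

Fact hecke_scalerAl (a : R) (x y : H) : a *: (x * y) = a *: x * y.
Proof. by rewrite -[a *: x * y]/(hecke_mulr y (a *: x)) linearZ. Qed.
HB.instance Definition _ := GRing.Lmodule_isLalgebra.Build R H hecke_scalerAl.

Fact hecke_scalerAr (a : R) (x y : H) : a *: (x * y) = x * (a *: y).
Proof. by rewrite -[x * (a *: y)]/(hecke_mul x (a *: y)) linearZ. Qed.
HB.instance Definition _ := GRing.Lalgebra_isAlgebra.Build R H hecke_scalerAr.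


Definition gen i : H := T (sp i).

Lemma mul_gen x i : valid i -> x * gen i = lin_ext (mulTi i) x.
Proof.
move=> vi; suff : hecke_mulr (gen i) =1 lin_ext (mulTi i) by apply.
apply: commL_eq => [|j y vj|]; first exact: commL_mul.
  by rewrite Lop_Rop.
rewrite /= lin_extT /hecke_mulr hecke_mul1l /mulTi mul1g len1.
case: ltnP => //; have [a [b [ab bi ei]]] := s_inP vi.
by move=> /(conj (lt_len_sr 1 ab bi)) []; rewrite invg1 !perm1 mul1g len1; lia.
Qed.

Lemma mulT_gen w i : valid i -> T w * gen i =
  if (plen w < plen (w * sp i)%g)%N then T (w * sp i)%g
  else (q - 1) *: T w + q *: T (w * sp i)%g.
Proof. by move=> vi; rewrite mul_gen // lin_extT. Qed.

Lemma T1 : T 1%g = 1.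
Proof. by []. Qed.

Lemma T_redword w : T w = \prod_(i <- redword w) gen i.
Proof.
elim/redword_ind: w => [|w i vi lt e IH]; first by rewrite /redword len1 big_nil.
by rewrite e -cats1 big_cat big_seq1 /= -IH mulT_gen // -mulgA sK mulg1 lt.
Qed.

Lemma gen_sqr i : valid i -> gen i * gen i = (q - 1) *: gen i + q *: 1.
Proof.
move=> vi; rewrite mulT_gen // sK len1 ltn0; congr (_ + _ *: _).
Qed.

Let mulT_gen_lt w i (a b : 'I_n) : a.+1 = b :> nat -> b = i :> nat ->
  (w^-1%g a < w^-1%g b)%N -> T w * gen i = T (w * sp i)%g.
Proof.
move=> ab bi lt; rewrite mulT_gen ?(lt_len_sr w ab bi) ?lt //.
by have := ltn_ord b; rewrite /valid; lia.
Qed.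

Let tpermDn (a b c : 'I_n) : a <> c :> nat -> b <> c :> nat -> tperm a b c = c.
Proof. by move=> ac bc; apply: tpermD; apply/eqP => /(congr1 val). Qed.

Lemma gen_comm i j : valid i -> valid j -> (i.+1 < j)%N ->
  gen i * gen j = gen j * gen i.
Proof.
move=> /s_inP[a [b [ab bi ei]]] /s_inP[c [d [cd dj ej]]] ij.
rewrite (mulT_gen_lt cd dj) ?(mulT_gen_lt ab bi) ?sV ?ei ?ej ?tpermDn; try lia.
congr T; apply/commgP/conjg_fixP; rewrite tpermJ !tpermDn //; lia.
Qed.

Lemma gen_braid i : valid i -> valid i.+1 ->
  gen i * gen i.+1 * gen i = gen i.+1 * gen i * gen i.+1.
Proof.
move=> /s_inP[a [b [ab bi ei]]] /s_inP[c [d [cd dj ej]]].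
have bc : b = c by apply: val_inj => /=; lia.
rewrite -{c}bc in cd ej.
have ia : sp i a = b by rewrite ei tpermL.
have ib : sp i b = a by rewrite ei tpermR.
have id : sp i d = d by rewrite ei tpermDn //; lia.
have ja : sp i.+1 a = a by rewrite ej tpermDn //; lia.
have jb : sp i.+1 b = d by rewrite ej tpermL.
have jd : sp i.+1 d = b by rewrite ej tpermR.
rewrite /gen -/(gen i) -/(gen i.+1).
rewrite (mulT_gen_lt cd dj) ?sV ?ib ?id; last by lia.
rewrite (mulT_gen_lt ab bi) ?invMg ?sV ?permM ?ja ?ia ?jb ?id; last by lia.
rewrite (mulT_gen_lt ab bi) ?sV ?ja ?jb; last by lia.
rewrite (mulT_gen_lt cd dj) ?invMg ?sV ?permM ?ib ?ja ?id ?jd; last by lia.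
congr T.
have e1 (u v : 'S_n) : (u^-1 = u -> u * v * u = v ^ u)%g.
  by move=> uV; rewrite conjgE uV mulgA.
by rewrite !e1 ?sV // {1}ej {2}ei !tpermJ ib id ja jb.
Qed.

End HeckeProduct.

Definition rmul_mx (R : comNzRingType) (n : nat) (q : R) (h : hecke n q) :
    'M[R]_#|{perm 'I_n}| :=
  \matrix_(i, j) coefT (T q (enum_val i) * h) (enum_val j).

Section RandomToRandom.
Variables (R : comNzRingType) (n : nat) (q : R).
Local Notation H := (hecke n q).

Definition qint (k : nat) : R := \sum_(i < k) q ^+ i.

Definition qfact (k : nat) : R := \prod_(i < k) qint i.+1.

Definition Bel (m : nat) : H :=
  \sum_(1 <= i < m.+1) \prod_(0 <= j < m - i) gen n q (m.-1 - j).

Definition Bel_star (m : nat) : H :=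
  \sum_(1 <= i < m.+1) \prod_(i <= j < m) gen n q j.

(* The truncated subtractions are harmless: Bel 0 = Bel_star 0 = 0. *)
Definition Belnk (k : nat) : H := \prod_(j < k) Bel (n - rev_ord j).

Definition Belnk_star (k : nat) : H := \prod_(j < k) Bel_star (n - j).

End RandomToRandom.

Section Specialization.
Variables (F : fieldType) (n : nat) (q : F).

Definition specialize (h : hecke n ('X : {poly F})) : hecke n q :=
  [ffun w : 'S_n => (coefT h w).[q] : F^o].

Definition lift_const (h : hecke n q) : hecke n ('X : {poly F}) :=
  [ffun w : 'S_n => (coefT h w)%:P : {poly F}^o].

End Specialization.

(* R_(n,k) for indeterminate q = 'X: each coefficient of B*_(n,k) B_(n,k) is a
   polynomial divisible by the monic polynomial [k]!_q, so that the Euclidean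
   division below is exact. *)
Definition R2R_generic (F : fieldType) (n k : nat) : hecke n ('X : {poly F}) :=
  [ffun w : 'S_n =>
    (coefT (Belnk_star n ('X : {poly F}) k * Belnk n 'X k) w %/ qfact 'X k)
      : {poly F}^o].

Definition R2R (F : fieldType) (n : nat) (q : F) (k : nat) : hecke n q :=
  specialize q (R2R_generic F n k).

Definition is_partition (n : nat) (la : seq nat) : bool :=
  [&& sorted geq la, 0%N \notin la & sumn la == n].

Definition conj_part (la : seq nat) : seq nat :=
  mkseq (fun j => count (fun x => j < x)%N la) (head 0%N la).

(* the row stabilizer of the tableau t^mu, filled row after row *)
Definition young (n : nat) (mu : seq nat) : {set 'S_n} :=
  [set w : 'S_n | [forall p, reshape_index mu (w p) == reshape_index mu p]].

(* t^la w_la = t_la, where t_la is filled column after column: w_la sends the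
   entry of t^la in row r and column c to the entry of t_la at the same place.
   The default values are never used when la is a partition of n, see
   w_partE. *)
Definition w_part (n : nat) (la : seq nat) : 'S_n :=
  insubd (1%g : 'S_n) ([ffun p : 'I_n => insubd p (flatten_index
    (conj_part la) (reshape_offset la p) (reshape_index la p))]
    : {ffun 'I_n -> 'I_n}).

Lemma nth_conj_part la j : (forall x, x \in la -> x <= head 0 la)%N ->
  nth 0%N (conj_part la) j = count (fun x => j < x)%N la.
Proof.
move=> le; have [lt|ge] := ltnP j (head 0%N la); first by rewrite nth_mkseq.
rewrite nth_default ?size_mkseq //; apply/esym/eqP.
rewrite -leqn0 leqNgt -has_count; apply/hasPn => x /le; lia.
Qed.

Lemma part_le_head la x : sorted geq la -> x \in la -> (x <= head 0 la)%N.
Proof.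
case: la => //= a la pa; rewrite inE => /orP[/eqP->//|xla].
by have /allP/(_ _ xla) := order_path_min (rev_trans leq_trans) pa.
Qed.

Lemma conj_part_gt la r c : sorted geq la -> (c < nth 0 la r)%N ->
  (r < nth 0 (conj_part la) c)%N.
Proof.
move=> sla lt; have rs : (r < size la)%N.
  by rewrite ltnNge; apply: contraTN lt => ge; rewrite nth_default.
rewrite nth_conj_part => [|x]; last exact: part_le_head.
rewrite -(cat_take_drop r.+1 la) count_cat; apply: ltn_addr.
suff /eqP -> : count (fun x => c < x)%N (take r.+1 la) == size (take r.+1 la).
  by rewrite size_take; case: ifP => //; lia.
rewrite -all_count; apply/(all_nthP 0%N) => i; rewrite size_take => lti.
have ir : (i <= r)%N by move: lti; case: ifP; lia.
rewrite nth_take //; apply: leq_trans lt _.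
have := sorted_leq_nth (rev_trans leq_trans) leqnn 0%N sla.
by move/(_ i r); rewrite !inE; apply => //; apply: leq_ltn_trans ir rs.
Qed.

Lemma sumn_conj_part la : sorted geq la -> sumn (conj_part la) = sumn la.
Proof.
move=> sla; rewrite /conj_part /mkseq sumnE big_map -{1}[head _ _]subn0 -/(index_iota _ _).
under eq_bigr do rewrite -sum1_count big_mkcond.
rewrite exchange_big sumnE /= big_seq [RHS]big_seq; apply: eq_bigr => x /(part_le_head sla) le.
rewrite -big_mkcond /= sum1_count -size_filter.
rewrite (_ : filter _ _ = index_iota 0 x) ?size_iota ?subn0 //.
apply: (@irr_sorted_eq _ ltn) => [||||i].
- exact: ltn_trans.
- exact: ltnn.
- by apply: sorted_filter; [exact: ltn_trans | exact: iota_ltn_sorted].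
- exact: iota_ltn_sorted.
- by rewrite mem_filter !mem_index_iota; lia.
Qed.

Lemma w_partE n la (p : 'I_n) : is_partition n la ->
  w_part n la p =
    flatten_index (conj_part la) (reshape_offset la p) (reshape_index la p) :> nat.
Proof.
case/and3P => sla _ /eqP sn; rewrite /w_part.
set f : {ffun 'I_n -> 'I_n} := finfun _.
have lt (x : 'I_n) :
    (reshape_index la x < nth 0 (conj_part la) (reshape_offset la x))%N.
  by apply: conj_part_gt => //; apply: reshape_offsetP; rewrite sn.
have fE x : f x =
    flatten_index (conj_part la) (reshape_offset la x) (reshape_index la x) :> nat.
  rewrite ffunE val_insubd ifT // -[X in (_ < X)%N]sn -sumn_conj_part //.
  exact: flatten_indexP.
have inj_f : injective f.
  move=> x y /(congr1 val) /=; rewrite !fE => e; apply: val_inj => /=.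
  have := congr1 (reshape_index (conj_part la)) e; rewrite !flatten_indexKl // => eo.
  have := congr1 (reshape_offset (conj_part la)) e; rewrite !flatten_indexKr // => ei.
  by rewrite -(reshape_indexK la x) -(reshape_indexK la y) eo ei.
rewrite -fE -pvalE val_insubd ifT //; exact/injectiveP.
Qed.

Section Specht.
Variables (R : comNzRingType) (n : nat) (q : R).
Local Notation H := (hecke n q).

Definition x_part (la : seq nat) : H := \sum_(w in young n la) T q w.

(* Dipper and James use the coefficients (-q)^(- len w), which require q to be
   invertible; in that case the common factor (-q)^N introduced here is a unit
   and does not affect the right ideal generated by z_part. *)
Definition y_part (mu : seq nat) : H :=
  let N := (\max_(w in young n mu) plen w)%N in
  \sum_(w in young n mu) (- q) ^+ (N - plen w) *: T q w.

Definition z_part (la : seq nat) : H :=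
  x_part la * T q (w_part n la) * y_part (conj_part la).

Definition is_ridl_basis (z : H) (d : nat) (b : 'I_d -> H) : Prop :=
  (forall x, (exists h, x = z * h) <-> exists c : 'I_d -> R, x = \sum_i c i *: b i)
  /\ (forall c : 'I_d -> R, \sum_i c i *: b i = 0 -> forall i, c i = 0).

(* A is the matrix of the right multiplication by h on the right ideal z H_n
   in some basis of this ideal *)
Definition ridl_rmul_mx (z h : H) (d : nat) (A : 'M[R]_d) : Prop :=
  exists2 b : 'I_d -> H, is_ridl_basis z b &
    forall i, b i * h = \sum_j A i j *: b j.

End Specht.

(* A is the matrix of the action of h on the Specht module S^la in some basis.
   For q <> 0, S^la is the right ideal z_la H_n. For q = 0 this ideal is in
   general too small, and S^la is obtained by specializing at 'X = 0 the module
   z_la H_n defined over F['X] for the indeterminate parameter 'X. *)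
Definition specht_mx (F : fieldType) (n : nat) (q : F) (la : seq nat)
    (h : hecke n q) (d : nat) (A : 'M[F]_d) : Prop :=
  if q == 0 then
    exists2 A' : 'M[{poly F}]_d,
      ridl_rmul_mx (z_part n 'X la) (lift_const h) A' &
      A = map_mx (horner_eval q) A'
  else ridl_rmul_mx (z_part n q la) h A.

Definition splits_nat_poly (F : fieldType) (q : F) (chi : {poly F}) : Prop :=
  exists ps : seq {poly nat},
    chi = \prod_(p <- ps) ('X - (map_poly (fun c : nat => c%:R) p).[q]%:P).

(* Main.v *)
Require Import Defs.
From HB Require Import structures.
From mathcomp Require Import all_boot all_order all_fingroup all_algebra.
From mathcomp Require Import zify ring.

Set Implicit Arguments.
Unset Strict Implicit.
Unset Printing Implicit Defensive.

Import GRing.Theory.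
Local Open Scope ring_scope.

(* A product of factors R_(n,k) - p(q) with p in N[t] is shown to vanish in the
   Hecke algebra. Then the matrix A of R_(n,k) on any free invariant module is
   killed by the same polynomial f, and det (f(x) - f(A)) is a multiple of
   char_poly A, so that char_poly A divides a power of f and splits.

   By specialization q may be taken generic. Let m be minimal such that
   y := u B*_n ... B*_(m+1) is nonzero. The relation
     R_(n,k) B*_n = B*_n (q^k R_(n-1,k) + ([n+1-k]_q + q^(n+1-k) J_n) R_(n-1,k-1))
   moves R_(n,k) to the right; since y B*_m = 0, it acts on y as a polynomial in
   the commuting Jucys-Murphy elements J_(m+1), ..., J_n. Their eigenvalues are
   q-contents [c]_q, and c >= -m because y T_i = q y for m < i < n. This bound
   makes each [n+1-k]_q + q^(n+1-k) [c]_q that occurs a q-integer [N]_q, N >= 0. *)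

(** * Shuffles and exact divisibility *)

(** Only the relations are recorded, for an arbitrary algebra: the computations are used over
    [{poly F}], for the divisibility by the q-factorial, and over its fraction field, for the
    eigenvalues. *)
Record hecke_rel (R : comNzRingType) (A : algType R) (q : R) (n : nat)
    (T : nat -> A) : Prop := HeckeRel {
  hecke_quad : forall i, (0 < i < n)%N -> T i * T i = (q - 1) *: T i + q *: 1;
  hecke_braid : forall i, (0 < i)%N -> (i.+1 < n)%N ->
    T i * T i.+1 * T i = T i.+1 * T i * T i.+1;
  hecke_comm : forall i j, (0 < i)%N -> (i.+1 < j)%N -> (j < n)%N ->
    GRing.comm (T i) (T j) }.

Section Shuffles.
Variables (R : comNzRingType) (A : algType R) (q : R) (n : nat) (T : nat -> A).
Hypothesis relT : hecke_rel q n T.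
Implicit Types (x y z : A) (m k i j a : nat).

Let scE := (=^~ @scalerAl R A, =^~ @scalerAr R A).

(** Horner form of B_m and B*_m. In [B 1] and [Bs 1] the meaningless [T 0] is multiplied by 0, so
    that inductions may start at m = 0. *)
Fixpoint B m : A := if m is m'.+1 then 1 + T m' * B m' else 0.
Fixpoint Bs m : A := if m is m'.+1 then 1 + Bs m' * T m' else 0.
Fixpoint Bnk m k : A := if k is k'.+1 then Bnk m.-1 k' * B m else 1.
Fixpoint Bnks m k : A := if k is k'.+1 then Bs m * Bnks m.-1 k' else 1.
Definition P m k : A := Bnks m k * Bnk m k.

Lemma commrZ (c : R) x y : GRing.comm x y -> GRing.comm x (c *: y).
Proof. by move=> cxy; rewrite /GRing.comm -scalerAl -scalerAr cxy. Qed.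

(* A substitute for "x lies in the subalgebra generated by T_1, ..., T_(m-1)" *)
Definition parab m x :=
  forall z, (forall i, (0 < i < m)%N -> GRing.comm z (T i)) -> GRing.comm z x.

Lemma parab1 m : parab m 1.
Proof. by move=> z _; apply: commr1. Qed.

Lemma parab0 m : parab m 0.
Proof. by move=> z _; apply: commr0. Qed.

Lemma parabD m x y : parab m x -> parab m y -> parab m (x + y).
Proof. by move=> hx hy z hz; apply: commrD; [apply: hx | apply: hy]. Qed.

Lemma parabM m x y : parab m x -> parab m y -> parab m (x * y).
Proof. by move=> hx hy z hz; apply: commrM; [apply: hx | apply: hy]. Qed.

Lemma parabT m i : (0 < i < m)%N -> parab m (T i).
Proof. by move=> hi z hz; apply: hz. Qed.

Lemma parabW m m' x : (m <= m')%N -> parab m x -> parab m' x.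
Proof. by move=> le hx z hz; apply: hx => i hi; apply: hz; lia. Qed.

Lemma parabZ m (c : R) x : parab m x -> parab m (c *: x).
Proof. by move=> hx z /hx; apply: commrZ. Qed.

Lemma parab_comm m x i : parab m x -> (m < i < n)%N -> GRing.comm x (T i).
Proof.
move=> hx hi; apply/commr_sym/hx => j hj; apply: commr_sym.
by apply: (hecke_comm relT); lia.
Qed.

Lemma parab_B m : parab m (B m).
Proof.
elim: m => [|[|m] IH] /=; [exact: parab0 | by rewrite mulr0 addr0; apply: parab1 |].
apply: parabD; first exact: parab1.
by apply: parabM; [apply: parabT; lia | apply: parabW _ IH; lia].
Qed.

Lemma parab_Bs m : parab m (Bs m).
Proof.
elim: m => [|[|m] IH] /=; [exact: parab0 | by rewrite mul0r addr0; apply: parab1 |].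
apply: parabD; first exact: parab1.
by apply: parabM; [apply: parabW _ IH; lia | apply: parabT; lia].
Qed.

Lemma parab_P m k : parab m (P m k).
Proof.
apply: parabM; elim: k m => [|k IH] m /=; try exact: parab1.
  by apply: parabM; [exact: parab_Bs | apply: parabW _ (IH _); lia].
by apply: parabM; [apply: parabW _ (IH _); lia | exact: parab_B].
Qed.

Lemma PS m k : P m.+1 k.+1 = Bs m.+1 * P m k * B m.+1.
Proof. by rewrite /P /= !mulrA. Qed.

Lemma P_0 m : P m 0 = 1.
Proof. by rewrite /P mul1r. Qed.

Lemma P_gt m k : (m < k)%N -> P m k = 0.
Proof.
rewrite /P => mk; suff -> : Bnks m k = 0 by rewrite mul0r.
elim: k m mk => // k IH [|m] mk /=; first by rewrite mul0r.
by rewrite IH ?mulr0.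
Qed.

Lemma Bs_comm m : (m.+1 < n)%N -> GRing.comm (Bs m) (T m.+1).
Proof. by move=> mn; apply: (parab_comm (@parab_Bs m)); lia. Qed.

Lemma B_comm m : (m.+1 < n)%N -> GRing.comm (B m) (T m.+1).
Proof. by move=> mn; apply: (parab_comm (@parab_B m)); lia. Qed.

(** The factor [Bs m] extends the braid relation to m = 0, where [T 0] is not a generator but
    [Bs 0 = 0]. *)
Lemma Bs_braid m : (m.+1 < n)%N ->
  Bs m * T m.+1 * T m * T m.+1 = Bs m * T m * T m.+1 * T m.
Proof.
case: m => [|m] mn; first by rewrite /= !mul0r.
by rewrite -!(mulrA (Bs _)) (hecke_braid relT).
Qed.

Lemma B_braid m : (m.+1 < n)%N ->
  T m.+1 * T m * T m.+1 * B m = T m * T m.+1 * T m * B m.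
Proof.
case: m => [|m] mn; first by rewrite /= !mulr0.
by rewrite (hecke_braid relT).
Qed.

(** Induction on m: once [Bs m.+2] is expanded, the quadratic relation handles one term, and in the
    other the braid relation sends T_(m+1) to the T_m of the induction hypothesis. *)
Lemma Bs_symm m : (m < n)%N -> Bs m.+1 * Bs m * T m = q *: (Bs m.+1 * Bs m).
Proof.
elim: m => [|m IH] mn; first by rewrite /= !mulr0 mul0r scaler0.
have {}IH := IH (ltnW mn).
have cb := Bs_comm mn; have br := Bs_braid mn.
set b := Bs m.+1 in IH *; rewrite -[Bs m.+2]/(1 + b * T m.+1).
have e : b * T m.+1 * b = b * T m.+1 + b * Bs m * T m.+1 * T m.
  by rewrite {2}/b /= mulrDr mulr1 !mulrA -(mulrA b) -cb !mulrA.
clearbody b.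
have e2 : b * Bs m * T m.+1 * T m * T m.+1 = q *: (b * Bs m * T m.+1 * T m).
  by rewrite -!(mulrA b) br !mulrA IH !scE.
rewrite !mulrDl !mul1r e mulrDl e2 -(mulrA b) (hecke_quad relT) //.
rewrite mulrDr !scE mulr1 scalerBl scale1r !scalerDr !addrA.
by rewrite [b * T m.+1 + _]addrC addrK [q *: b + _]addrC.
Qed.

Lemma B_symm m : (m < n)%N -> T m * (B m * B m.+1) = q *: (B m * B m.+1).
Proof.
elim: m => [|m IH] mn; first by rewrite /= !(mul0r, mulr0) scaler0.
have {}IH := IH (ltnW mn).
have cb := B_comm mn; have br := B_braid mn.
set b := B m.+1 in IH *; rewrite -[B m.+2]/(1 + T m.+1 * b).
have e : b * T m.+1 * b = T m.+1 * b + T m * T m.+1 * B m * b.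
  by rewrite {1}/b /= !mulrDl !mul1r -!mulrA (mulrA (B m)) cb !mulrA.
clearbody b.
have e2 : T m.+1 * (T m * T m.+1 * B m * b) = q *: (T m * T m.+1 * B m * b).
  by rewrite !mulrA br -[X in _ = q *: X]mulrA -!mulrA IH !scE !mulrA.
rewrite (mulrDr b) mulr1 (mulrA b) e !mulrDr e2 (mulrA _ _ b) (hecke_quad relT) //.
rewrite mulrDl !scE mul1r scalerBl scale1r !scalerDr !addrA.
by rewrite [T m.+1 * b + _]addrC addrK [q *: b + _]addrC.
Qed.

(** [T i] commutes with every factor of index below [i] and is absorbed by the next two,
    [B i * B i.+1]. *)
Lemma Bnk_symm m k i : (m <= n)%N -> (k <= m)%N -> (m - k < i < m)%N ->
  T i * Bnk m k = q *: Bnk m k.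
Proof.
elim: k m => [|k IH] [|m] mn km hi /=; try lia.
have [im|im] := ltnP i m; first by rewrite mulrA IH ?scE //; lia.
have -> : i = m by lia.
case: k {IH} km hi => [|k] km hi /=; first by lia.
case: m mn km hi im => [|m] mn km hi im; first lia.
rewrite -/(B m.+2).
have cT : GRing.comm (Bnk m k) (T m.+1).
  apply: (@parab_comm m) => //; last by lia.
  elim: (k) (m) => [|k' IH] m' /=; first exact: parab1.
  by apply: parabM; [apply: parabW _ (IH _); lia | exact: parab_B].
by rewrite -!mulrA mulrA -cT -!mulrA B_symm ?scE //; lia.
Qed.

Lemma Bnks_symm m k i : (m <= n)%N -> (k <= m)%N -> (m - k < i < m)%N ->
  Bnks m k * T i = q *: Bnks m k.
Proof.
elim: k m => [|k IH] [|m] mn km hi /=; try lia.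
have [im|im] := ltnP i m; first by rewrite -mulrA IH ?scE //; lia.
have -> : i = m by lia.
case: k {IH} km hi => [|k] km hi /=; first by lia.
case: m mn km hi im => [|m] mn km hi im; first lia.
rewrite -/(Bs m.+2) !mulrA.
have cT : GRing.comm (Bnks m k) (T m.+1).
  apply: (@parab_comm m) => //; last by lia.
  elim: (k) (m) => [|k' IH] m' /=; first exact: parab1.
  by apply: parabM; [exact: parab_Bs | apply: parabW _ (IH _); lia].
by rewrite -mulrA cT mulrA Bs_symm ?scE //; lia.
Qed.

(** * q-integers and q-shuffles *)

Definition qnum k : R := \sum_(i < k) q ^+ i.

Lemma qnumS k : qnum k.+1 = qnum k + q ^+ k.
Proof. by rewrite /qnum big_ord_recr. Qed.

Lemma qnumSl k : qnum k.+1 = 1 + q * qnum k.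
Proof.
rewrite /qnum big_ord_recl expr0 mulr_sumr; congr (_ + _).
by apply: eq_bigr => i _; rewrite exprS.
Qed.

(** Descending product T_(a+l) ... T_a, with l + 1 factors rather than l. *)
Fixpoint dnT a l : A := if l is l'.+1 then T (a + l) * dnT a l' else T a.

(* The q-shuffles of the letters 1, ..., a with j identical letters that start
   at the positions a + 1, ..., a + j; the recursion looks at the last letter. *)
Fixpoint shuf a : nat -> A :=
  if a is a'.+1 then
    fix G j := if j is j'.+1 then G j' + shuf a' j'.+1 * dnT a j' else 1
  else fun=> 1.

Lemma shuf0 a : shuf a 0 = 1.
Proof. by case: a. Qed.

Lemma shufS a j : shuf a.+1 j.+1 = shuf a.+1 j + shuf a j.+1 * dnT a.+1 j.
Proof. by []. Qed.

Lemma parab_dnT a l : (0 < a)%N -> parab (a + l).+1 (dnT a l).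
Proof.
move=> a0; elim: l => [|l IH] /=; first by apply: parabT; lia.
by apply: parabM; [apply: parabT; lia | apply: parabW _ IH; lia].
Qed.

Lemma parab_shuf a j : parab (a + j) (shuf a j).
Proof.
elim: a j => [|a IH] j; first exact: parab1.
elim: j => [|j IHj]; first exact: parab1.
rewrite shufS; apply: parabD; first by apply: parabW _ IHj; lia.
apply: parabM; first by apply: parabW _ (IH _); lia.
by apply: (parabW _ (@parab_dnT a.+1 j _)); lia.
Qed.

(** By the braid relations, T_i T_(a+l) ... T_a = T_(a+l) ... T_a T_(i+1), and [y] absorbs
    T_(i+1). *)
Lemma dnT_symm a l y i : (0 < a)%N -> (a + l < n)%N ->
  (forall i, (a < i <= a + l)%N -> T i * y = q *: y) ->
  (a <= i < a + l)%N -> T i * (dnT a l * y) = q *: (dnT a l * y).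
Proof.
move=> a0; elim: l => [|l IH] aln hy hi; first lia.
rewrite /=; have [il|il] := ltnP i (a + l).
  rewrite mulrA mulrA (_ : T i * T (a + l.+1) = T (a + l.+1) * T i); last first.
    by apply: (hecke_comm relT); lia.
  by rewrite -!mulrA IH ?scE //; [lia | move=> i' hi'; apply: hy; lia | lia].
have ei : i = (a + l)%N by lia.
rewrite {}ei.
case: l {IH hi il} aln hy => [|l] aln hy /=.
  rewrite addn0 addn1 !mulrA (hecke_braid relT); try lia.
  by rewrite -!mulrA hy ?scE //; lia.
rewrite !mulrA !addnS (hecke_braid relT); try lia.
have c : GRing.comm (dnT a l) (T (a + l).+2).
  by apply: (parab_comm (@parab_dnT a l a0)); lia.
by rewrite -!mulrA (mulrA (T (a + l).+2) (dnT a l)) -c -!mulrA hy ?scE //; lia.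
Qed.

(** Inserting one more identical letter yields each shuffle with j + 1 such letters, weighted by
    [j+1]_q because [y] is symmetric in them. The double induction follows the recursion of [shuf];
    [y] varies since the outer hypothesis is applied to [dnT a.+1 j.+1 * y]. *)
Lemma Bs_shuf a j y : (a + j < n)%N ->
  (forall i, (a < i <= a + j)%N -> T i * y = q *: y) ->
  Bs (a + j).+1 * (shuf a j * y) = qnum j.+1 *: (shuf a j.+1 * y).
Proof.
elim: a j y => [|a IHa] j y ajn hy.
  rewrite add0n /= !mul1r -/(Bs j.+1).
  suff H l : (l <= j)%N -> Bs l.+1 * y = qnum l.+1 *: y by apply: H.
  elim: l => [|l IH] lj; first by rewrite /= mul0r addr0 mul1r /qnum big_ord1 scale1r.
  rewrite -[Bs l.+2]/(1 + Bs l.+1 * T l.+1) qnumSl scalerDl scale1r mulrDl mul1r.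
  rewrite -mulrA hy ?scE; last by lia.
  by rewrite IH 1?ltnW // scalerA.
have hd : forall i, (a < i <= a + j)%N ->
    T i * (dnT a.+1 j * y) = q *: (dnT a.+1 j * y).
  by move=> i hi; apply: dnT_symm => // *; try apply: hy; lia.
elim: j ajn hy hd => [|j IHj] ajn hy hd.
  have e : Bs (a + 0).+1 = shuf a 1.
    have := IHa 0%N 1; rewrite shuf0 !mulr1 /qnum big_ord1 scale1r.
    by apply; [lia | move=> i; lia].
  rewrite shufS shuf0 mul1r /qnum big_ord1 scale1r -e !addn0 /= -/(Bs a.+1).
  by rewrite !mulrDl !mul1r.
have hy' : forall i, (a.+1 < i <= a.+1 + j)%N -> T i * y = q *: y.
  by move=> i hi; apply: hy; lia.
rewrite addnS [Bs _]/= mulrDl mul1r -/(Bs (a.+1 + j).+1) -mulrA.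
have c1 : GRing.comm (shuf a.+1 j) (T (a.+1 + j.+1)).
  by apply: (parab_comm (@parab_shuf _ _)); lia.
have c2 : GRing.comm (shuf a j.+1) (T (a.+1 + j.+1)).
  by apply: (parab_comm (@parab_shuf _ _)); lia.
have -> : T (a.+1 + j).+1 * (shuf a.+1 j.+1 * y) =
    q *: (shuf a.+1 j * y) + shuf a j.+1 * (dnT a.+1 j.+1 * y).
  rewrite -addnS shufS mulrDl mulrDr; congr (_ + _).
    by rewrite mulrA -c1 -mulrA hy ?scE //; lia.
  by rewrite !mulrA -c2.
rewrite -/(Bs (a.+1 + j).+1) mulrDr scE IHj //; last 2 first.
- by lia.
- by move=> i hi; apply: dnT_symm => // *; try apply: hy; lia.
have -> : (a.+1 + j = a + j.+1)%N by lia.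
rewrite IHa //; last by lia.
(* The terms in [shuf a.+1 j.+1] add up to 1 + q [j+1]_q = [j+2]_q, which is also the coefficient of
   the remaining term. *)
rewrite addrA scalerA -{1}[shuf a.+1 j.+1 * y]scale1r -scalerDl -qnumSl -scalerDr.
by rewrite mulrA -mulrDl.
Qed.

(** An explicit quotient by [k]!_q over any commutative ring, found by applying the factors [Bs] one
    at a time to the symmetric element [Bnk m k]. *)
Lemma P_shuf m k : (m <= n)%N -> (k <= m)%N ->
  P m k = (\prod_(i < k) qnum i.+1) *: (shuf (m - k) k * Bnk m k).
Proof.
move=> mn km; rewrite /P.
have hy i : (m - k < i < m)%N -> T i * Bnk m k = q *: Bnk m k by exact: Bnk_symm.
move: (Bnk m k) hy => y hy.
suff H l : (l <= k)%N -> Bnks (m - k + l) l * y =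
    (\prod_(i < l) qnum i.+1) *: (shuf (m - k) l * y).
  by have := H k (leqnn k); rewrite subnK.
elim: l => [|l IH] lk; first by rewrite big_ord0 /= scale1r shuf0.
rewrite addnS [Bnks _ _]/= -/(Bs (m - k + l).+1) -mulrA IH 1?ltnW // scE.
rewrite Bs_shuf; last 2 first.
- by lia.
- by move=> i hi; apply: hy; lia.
by rewrite big_ord_recr /= scalerA.
Qed.

End Shuffles.

(** * Jucys-Murphy elements *)

Section JucysMurphy.
Variables (K : fieldType) (A : algType K) (q : K) (n : nat) (T : nat -> A).
Hypothesis relT : hecke_rel q n T.
Hypothesis q0 : q != 0.
Implicit Types (x y z : A) (m k i j : nat) (s : seq int).

Local Notation B := (B T).
Local Notation Bs := (Bs T).
Local Notation Bnk := (Bnk T).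
Local Notation Bnks := (Bnks T).
Local Notation P := (P T).
Local Notation qnum := (qnum q).

(* L m = 1 + (q - 1) J_m, where J_m is the m-th Jucys-Murphy element *)
Fixpoint L m : A :=
  if m is m'.+1 then if m' is 0 then 1 else q^-1 *: (T m' * L m' * T m') else 1.

Lemma LS m : (0 < m)%N -> L m.+1 = q^-1 *: (T m * L m * T m).
Proof. by case: m. Qed.

(* [N]_q + q^N J_m *)
Definition JM N m : A := (q - 1)^-1 *: (q ^+ N *: L m - 1).

Lemma parab_L m : (0 < m)%N -> parab T m (L m).
Proof.
elim: m => // -[|m] IH _; first exact: parab1.
rewrite LS //; apply/parabZ/parabM; last by apply: parabT; lia.
by apply: parabM; [apply: parabT; lia | apply: parabW _ (IH _); lia].
Qed.

(** For i = m - 1, the braid relation turns T_(m-1) into T_m as it passes T_m T_(m-1); T_m commutes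
    with L_(m-1) and is turned back into T_(m-1) on the other side. *)
Lemma L_comm_T m i : (m < n)%N -> (0 < i < m)%N -> GRing.comm (L m.+1) (T i).
Proof.
elim: m i => [|m IH] i mn im; first lia.
rewrite LS //; apply: commr_sym; rewrite /GRing.comm -!(scalerAl, scalerAr).
congr (_ *: _); have [im'|im'] := ltnP i m.
  have c1 : GRing.comm (T i) (T m.+1) by apply: (hecke_comm relT); lia.
  have c2 : GRing.comm (T i) (L m.+1) by apply/commr_sym/IH; lia.
  by rewrite -/(GRing.comm _ _); apply: commrM => //; apply: commrM.
have ei : i = m by lia.
move: im; rewrite {im'}ei; case: m {IH} mn => [|m] mn im; first lia.
have c : GRing.comm (L m.+1) (T m.+2) by apply: (parab_comm relT (parab_L _)); lia.
rewrite (LS (m := m.+1)) // -!(scalerAl, scalerAr); congr (_ *: _).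
have br := hecke_braid relT (i := m.+1) isT mn.
rewrite !mulrA br -!mulrA; congr (_ * (_ * _)).
by rewrite 2!mulrA -c -!mulrA; congr (_ * _); rewrite !mulrA br.
Qed.

Lemma L_comm_parab m x : (m < n)%N -> parab T m x -> GRing.comm (L m.+1) x.
Proof. by move=> mn hx; apply: hx => i hi; apply: L_comm_T. Qed.

Lemma L_comm i j : (i <= n)%N -> (j <= n)%N -> GRing.comm (L i) (L j).
Proof.
wlog ij : i j / (i <= j)%N.
  move=> H hi hj; have [ij|ji] := leqP i j; first exact: H.
  by apply/commr_sym/H => //; apply: ltnW.
case: j ij => [|j] ij hi hj; first exact: commr1.
move: ij; rewrite leq_eqVlt => /orP[/eqP-> //|ij].
case: i ij hi => [|i] ij hi; first exact/commr_sym/commr1.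
by apply/commr_sym/L_comm_parab => //; apply: parabW _ (parab_L _).
Qed.

Lemma JM_comm N m x : GRing.comm (L m) x -> GRing.comm (JM N m) x.
Proof.
move=> c; rewrite /GRing.comm /JM -scalerAl -scalerAr; congr (_ *: _).
by rewrite mulrBl mulrBr mul1r mulr1 -scalerAl -scalerAr c.
Qed.

(** Multiply q L_(m+1) = T_m L_m T_m by T_m on the left and apply the quadratic relation. *)
Lemma LT m : (0 < m < n)%N -> L m * T m = T m * L m.+1 - (q - 1) *: L m.+1.
Proof.
move=> hm; apply: (scalerI q0); rewrite LS; last by lia.
rewrite scalerBr -scalerAr scalerA mulfV // scale1r.
have -> : q *: ((q - 1) *: (q^-1 *: (T m * L m * T m))) = (q - 1) *: (T m * L m * T m).
  by rewrite !scalerA; congr (_ *: _); field.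
rewrite -(mulrA (T m)) (mulrA (T m) (T m)) (hecke_quad relT) // mulrDl -!scalerAl mul1r.
by rewrite addrAC subrr add0r.
Qed.

(** * Exchange relations for B*_(m,k) B_(m,k) *)

Hypothesis q1 : q - 1 != 0.

(** This exchange creates the Jucys-Murphy elements. In the induction, expanding both factors leaves
    T_(m+1) B_(m+1) B*_(m+1) T_(m+1), and T_(m+1) L_(m+1) T_(m+1) = q L_(m+2). *)
Lemma BBs m : (m < n)%N -> B m.+1 * Bs m.+1 = Bs m * T m * B m + JM m.+1 m.+1.
Proof.
elim: m => [|m IH] mn.
  rewrite /= !(mulr0, mul0r) addr0 mulr1 /JM /= expr1 add0r.
  by rewrite -[X in _ *: (_ - X)]scale1r -scalerBl scalerA mulVf ?scale1r.
have {}IH := IH (ltnW mn).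
set b := B m.+1 in IH *; set bs := Bs m.+1 in IH *.
rewrite -[B m.+2]/(1 + T m.+1 * b) -[Bs m.+2]/(1 + bs * T m.+1).
have cb := B_comm relT mn; have cs := Bs_comm relT mn; have br := Bs_braid relT mn.
have eJ : T m.+1 * JM m.+1 m.+1 * T m.+1 = JM m.+2 m.+2 - 1 - T m.+1.
  rewrite /JM -scalerAr -scalerAl mulrBr mulrBl mulr1 -scalerAr -scalerAl.
  rewrite (hecke_quad relT) //.
  have -> : T m.+1 * L m.+1 * T m.+1 = q *: L m.+2.
    by rewrite (LS (m := m.+1)) // scalerA mulfV // scale1r.
  have -> : q%:A = (q - 1)%:A + 1 :> A by rewrite scalerBl scale1r subrK.
  apply: (scalerI q1); rewrite !scalerBr !(scalerA (q - 1)) mulfV // !scale1r.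
  rewrite scalerA -exprSr !opprD [- _ + (- _ - _)]addrC -!addrA.
  by congr (_ + _); rewrite addrCA.
have -> : (1 + T m.+1 * b) * (1 + bs * T m.+1) =
    1 + T m.+1 * b + bs * T m.+1 + (T m.+1 * (b * bs) * T m.+1).
  by rewrite mulrDl mul1r mulrDr mulr1 !mulrA -!addrA; congr (_ + _); rewrite addrCA.
have eb : b = 1 + T m * B m by [].
have es : bs = 1 + Bs m * T m by [].
clearbody b bs; rewrite IH mulrDr mulrDl eJ.
have -> : T m.+1 * (Bs m * T m * B m) * T m.+1 = Bs m * T m * T m.+1 * T m * B m.
  rewrite -br !mulrA -cs -!mulrA; congr (_ * (_ * (_ * _))); exact: cb.
rewrite eb es !mulrDl !mulrDr !mul1r !mulr1.
move: (JM _ _) => J; rewrite !mulrA.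
move: (T m.+1) (T m.+1 * T m * B m) (Bs m * T m * T m.+1) (_ * _ * _ * _ * _) => t u v w.
rewrite [J - 1 - t]addrAC.
rewrite [LHS](AC ((1*2)*2*(1*3)) ((2*3)*(5*6)*7*((1*9)*(4*8)))).
by rewrite /= !subrr !addr0.
Qed.

(** By [LT], x L_m T_m = x L_(m+1), as q - (q - 1) = 1. The constant term gains a factor q, whence
    the drop from N + 1 to N. *)
Lemma symm_JM_T x N m : (0 < m < n)%N -> x * T m = q *: x ->
  x * (JM N.+1 m * T m) = q *: (x * JM N m.+1).
Proof.
move=> hm xT; rewrite /JM -scalerAl -!scalerAr scalerA mulrC -scalerA; congr (_ *: _).
rewrite mulrBl mul1r -scalerAl LT // mulrBr xT -scalerAr mulrBr mulrA xT.
rewrite -!scalerAr -scalerAl -scalerBl (_ : q - (q - 1) = 1); last by ring.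
by rewrite scale1r exprS mulrBr mulr1 scalerBr -scalerAr scalerA.
Qed.

(** The relation between R_(n,k) and B*_n, cleared of the q-factorial. Induction on m: [BBs]
    exchanges the inner factors, the induction hypothesis moves the shorter product past [Bs m.+1],
    and B*_(m+2) B*_(m+1) absorbs the remaining T_(m+1). *)
Lemma P_rec m k : (m < n)%N -> P m.+1 k.+1 * Bs m.+1 = Bs m.+1 *
  (q ^+ k.+1 *: P m k.+1 + qnum k.+1 *: (JM (m.+1 - k) m.+1 * P m k)).
Proof.
elim: m k => [|m IH] [|k] mn.
- rewrite PS !P_0 P_gt // -!mulrA mul1r BBs // !(mul0r, mulr1, scaler0, add0r).
  by rewrite /qnum big_ord1 scale1r.
- by rewrite PS !P_gt // !(mulr0, mul0r, scaler0, addr0).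
- rewrite !PS !P_0 -!mulrA !mul1r mulr1 BBs //.
  move: (Bs m.+2) (Bs m.+1) (B m.+1) (Bs_symm relT mn) => X Y Z XY.
  rewrite mulrDr mulrDr !mulrA XY /qnum big_ord1 scale1r expr1.
  by rewrite -!scalerAr -!scalerAl !mulrA.
have {}IH := IH k (ltnW mn).
rewrite PS -(mulrA _ (B _)) BBs // -mulrA (mulrDr (P _ _)) !(mulrDr (Bs m.+2)).
move: IH.
have XY := Bs_symm relT mn; have PE k' := PS T m k'.
have pY : parab T m.+1 (Bs m.+1) by exact: parab_Bs.
move: XY PE pY; move: (Bs m.+2) (Bs m.+1) (B m.+1) => X Y Z XY PE pY IH.
have cP k' : GRing.comm (P m k') (T m.+1).
  by apply: (parab_comm relT (@parab_P _ _ T m k')); lia.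
have cL x : parab T m.+1 x -> GRing.comm (L m.+2) x by apply: L_comm_parab.
have cP' : GRing.comm (JM m.+2 m.+2) (P m.+1 k.+1).
  by apply/JM_comm/cL/parab_P.
(* For k > m all products vanish; otherwise the truncated subtractions below are exact. *)
have [km|km] := leqP k m; last first.
  have P0 k' : (k <= k')%N -> P m.+1 k'.+1 = 0 by move=> h; apply: P_gt; lia.
  by rewrite !P0 // !(mulr0, mul0r, scaler0, addr0).
have eJ : X * Y * (JM (m.+1 - k) m.+1 * T m.+1) = q *: (X * Y * JM (m - k) m.+2).
  by rewrite subSn //; apply: symm_JM_T.
have cJ : GRing.comm (JM (m - k) m.+2) Y by apply/JM_comm/cL.
(* Both coefficients reduce to [k+2]_q: that of L through [k+1]_q + q^(k+1), the constant one
   through 1 + q [k+1]_q. *)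
have eJ2 : (qnum k.+1 * q) *: JM (m - k) m.+2 + JM m.+2 m.+2 =
    qnum k.+2 *: JM (m.+2 - k.+1) m.+2.
  rewrite /JM !(scalerA, scalerBr, mulr1) addrACA -opprD -!scalerDl; congr (_ *: _ - _ *: _).
    rewrite subSS subSn // (qnumS q k.+1) -{2}(subnK km) -addnS -addSn.
    by rewrite exprD !exprS; field; rewrite q0.
  by rewrite (qnumSl q k.+1); field.
move: PE IH cP cP' eJ cJ eJ2; move: (P m.+1) (P m) => p1 p0 PE IH cP cP'.
move: (JM (m.+1 - k) m.+1) (JM (m - k) m.+2) (JM m.+2 m.+2) (JM (m.+2 - k.+1) m.+2) IH cP'.
move=> J0 J1 J2 J3 IH cP' eJ cJ eJ2.
have e1 : X * (p1 k.+1 * (Y * T m.+1 * Z)) =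
    q ^+ k.+2 *: (X * p1 k.+2) + qnum k.+1 *: (q *: (X * (J1 * p1 k.+1))).
  rewrite !mulrA -(mulrA X) IH 2!mulrDr !mulrDl !PE; congr (_ + _).
    rewrite -!(scalerAl, scalerAr) !mulrA -(mulrA _ (p0 k.+1) (T _)) cP !mulrA XY.
    by rewrite -!scalerAl scalerA -exprSr.
  rewrite -!(scalerAl, scalerAr); congr (_ *: _); rewrite !mulrA.
  rewrite -(mulrA _ (p0 k) (T _)) cP !mulrA -(mulrA (X * Y) J0) eJ.
  rewrite -!scalerAl; congr (_ *: (_ * _ * _)).
  by rewrite -!mulrA cJ.
rewrite e1 -cP' -!scalerAr -addrA; congr (_ + _).
by rewrite scalerA !(scalerAr _ X) !(scalerAl _ _ (p1 _)) -mulrDr -mulrDl eJ2.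
Qed.

End JucysMurphy.

(** * Eigenvalues for generic q *)

Section NatPoly.
Variables (R : comNzRingType) (q : R).

Definition nat_eval (p : {poly nat}) : R := (map_poly (fun c : nat => c%:R) p).[q].

Definition nat_poly (x : R) := exists p, x = nat_eval p.

Lemma nat_poly0 : nat_poly 0.
Proof. by exists 0; rewrite /nat_eval rmorph0 horner0. Qed.

Lemma nat_poly1 : nat_poly 1.
Proof. by exists 1; rewrite /nat_eval rmorph1 hornerC. Qed.

Lemma nat_polyD x y : nat_poly x -> nat_poly y -> nat_poly (x + y).
Proof.
by move=> [p ->] [p' ->]; exists (p + p'); rewrite /nat_eval rmorphD hornerD.
Qed.

Lemma nat_polyM x y : nat_poly x -> nat_poly y -> nat_poly (x * y).
Proof.
by move=> [p ->] [p' ->]; exists (p * p'); rewrite /nat_eval rmorphM hornerM.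
Qed.

Lemma nat_polyXn k : nat_poly (q ^+ k).
Proof. by exists 'X^k; rewrite /nat_eval map_polyXn hornerXn. Qed.

Lemma nat_poly_qnum k : nat_poly (qnum q k).
Proof.
elim: k => [|k IH]; first by rewrite /qnum big_ord0; apply: nat_poly0.
by rewrite qnumS; apply: nat_polyD => //; apply: nat_polyXn.
Qed.

End NatPoly.

(** * Spectrum of the Jucys-Murphy elements *)

Section Eigenvalues.
Variables (K : fieldType) (A : algType K) (q : K) (n : nat) (T : nat -> A).
Hypothesis relT : hecke_rel q n T.
Hypotheses (q0 : q != 0) (q1 : q - 1 != 0) (q2 : 1 + q != 0).
Hypothesis qnum0 : forall k, qnum q k.+1 != 0.
Implicit Types (x y z u : A) (m k i j d : nat) (s : seq int) (c e : int).

Local Notation B := (B T).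
Local Notation Bs := (Bs T).
Local Notation Bnk := (Bnk T).
Local Notation Bnks := (Bnks T).
Local Notation P := (P T).
Local Notation L := (L q T).
Local Notation JM := (JM q T).
Local Notation qnum := (qnum q).

(** Since L_j = 1 + (q - 1) J_j, the eigenvalue q^c of L_j stands for the q-content [c]_q of J_j; c
    may be negative. *)
Definition qpol s x : A := \prod_(c <- s) (x - (q ^ c)%:A).

Lemma scalar_comm (a : K) x : GRing.comm x (a%:A).
Proof. by rewrite /GRing.comm mulr_algr mulr_algl. Qed.

Lemma qpol_comm s x y : GRing.comm y x -> GRing.comm y (qpol s x).
Proof.
move=> c; rewrite /qpol; elim/big_rec: _ => [|a z _ IH]; first exact: commr1.
by apply: commrM => //; apply: commrB => //; apply: scalar_comm.
Qed.

Lemma qpol_cons c s x : qpol (c :: s) x = (x - (q ^ c)%:A) * qpol s x.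
Proof. by rewrite /qpol big_cons. Qed.

Lemma qpol_cat s s' x : qpol (s ++ s') x = qpol s x * qpol s' x.
Proof. by rewrite /qpol big_cat. Qed.

(* The Bernstein relation between T_m and a polynomial in L_m, multiplied by
   L_m - L_(m+1) to clear the divided difference. *)
Lemma qpol_T m s : (0 < m < n)%N ->
  qpol s (L m) * T m * (L m - L m.+1) =
  T m * qpol s (L m.+1) * (L m - L m.+1)
    - (q - 1) *: (L m.+1 * (qpol s (L m) - qpol s (L m.+1))).
Proof.
move=> hm; have cL : GRing.comm (L m) (L m.+1) by apply: (L_comm relT); lia.
have LTm := LT relT q0 hm.
move: (L m) (L m.+1) (T m) cL LTm => l l' t cl lt.
elim: s => [|c s IH].
  by rewrite /qpol !big_nil subrr mulr0 scaler0 subr0 mul1r mulr1.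
rewrite !qpol_cons; set r := (q ^ c)%:A; set f := qpol s l in IH *.
set f' := qpol s l' in IH *.
have cr x : GRing.comm x r by apply: scalar_comm.
have clf' : GRing.comm l f' by apply: qpol_comm.
have cl'f' : GRing.comm l' f' by apply: qpol_comm.
have clf : GRing.comm l f by apply: qpol_comm.
have e : (l - r) * t = t * (l' - r) - (q - 1) *: l'.
  by rewrite mulrBl mulrBr lt cr addrAC.
rewrite -[X in X * _ = _]mulrA -[LHS]mulrA IH mulrBr -scalerAr.
clearbody f f' r; rewrite !mulrA e 2!mulrBl -!addrA; congr (_ + _).
rewrite -!scalerAl -opprD -scalerDr; congr (- (_ *: _)).
have -> : (l - r) * l' = l' * (l - r).
  by rewrite mulrBl mulrBr cl cr.
rewrite -!mulrA -mulrDr; congr (_ * _).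
rewrite (mulrBr f') (mulrBr (l - r)) !(mulrBl f') clf' cl'f' !opprB.
move: (f' * l) (f' * l') (r * f') ((l - r) * f) => a b d g.
by rewrite [LHS](AC (2*(1*2)) ((3*(4*2))*(1*5))) /= subrr addr0.
Qed.

Definition ann s x y := y * qpol s x = 0.

Lemma ann_catl s s' x y : ann s x y -> ann (s ++ s') x y.
Proof. by rewrite /ann qpol_cat mulrA => ->; rewrite mul0r. Qed.

Lemma ann_catr s s' x y : ann s' x y -> ann (s ++ s') x y.
Proof.
rewrite /ann qpol_cat (qpol_comm s' (y := qpol s x)) ?mulrA => [->|].
  by rewrite mul0r.
exact/commr_sym/qpol_comm.
Qed.

Lemma qpol_shift s e x x' z : GRing.comm x x' -> z * x' = (q ^ e) *: (z * x) ->
  z * qpol (map (fun c => c + e) s) x' = ((q ^ e) ^+ size s) *: (z * qpol s x).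
Proof.
move=> cx; elim: s z => [|c s IH] z zx; first by rewrite /qpol !big_nil expr0 scale1r.
rewrite /= !qpol_cons exprS !mulrA.
have -> : z * (x' - (q ^ (c + e))%:A) = q ^ e *: (z * (x - (q ^ c)%:A)).
  rewrite !mulrBr zx scalerBr !mulr_algr scalerA; congr (_ - _ *: _).
  by rewrite expfzDr // mulrC.
rewrite -scalerAl IH ?scalerA //.
rewrite !mulrBr !mulrBl !mulr_algr -mulrA cx mulrA zx.
by rewrite scalerBr -!scalerAl zx !scalerA mulrC.
Qed.

(** Put w = y [qpol s (L m.+1)]. As [y] is killed by [qpol s (L m)], the Bernstein relation reduces
    to w L_(m+1) = q^e w L_m, so that the shifted polynomial in L_(m+1) kills w. The pairs (t, e)
    that occur are (q, 1) and (-1, -1). *)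
Lemma ann_step m s (t : K) e y : (0 < m < n)%N -> t + 1 - q != 0 ->
    t = q ^ e * (t + 1 - q) -> y * T m = t *: y -> ann s (L m) y ->
  ann (s ++ map (fun c => c + e) s) (L m.+1) y.
Proof.
move=> hm t0 te yT; rewrite /ann qpol_cat mulrA => ys.
have cL : GRing.comm (L m) (L m.+1) by apply: (L_comm relT); lia.
rewrite (@qpol_shift s e (L m)) //.
  rewrite -mulrA (qpol_comm s (x := L m)); last exact/commr_sym/qpol_comm/commr_sym.
  by rewrite mulrA ys mul0r scaler0.
have c1 : GRing.comm (L m.+1) (qpol s (L m)) by apply/qpol_comm/commr_sym.
have c2 : GRing.comm (L m.+1) (qpol s (L m.+1)) by apply: qpol_comm.
have := congr1 (fun x => y * x) (qpol_T s hm).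
move: ys c1 c2; move: (qpol s (L m)) (qpol s (L m.+1)) => f f'.
move: (L m) (L m.+1) => l l' ys c1 c2.
rewrite -(mulrA f) mulrA ys mul0r (mulrBr y) !mulrA yT -!scalerAl -scalerAr.
rewrite (mulrBr l') c1 c2 -mulrBl mulrA (mulrBr y) ys sub0r mulNr scalerN opprK.
move: (y * f') => w /esym e0; apply: (scalerI t0).
rewrite scalerA [_ * q ^ e]mulrC -te; apply/esym/eqP; rewrite -subr_eq0 -e0; apply/eqP.
rewrite mulrBr scalerBr -[RHS]addrA; congr (_ + _).
by rewrite -!scaleNr -scalerDl; congr (_ *: _); ring.
Qed.

Lemma ann_scale s x y (a : K) : a != 0 -> ann s x (a *: y) -> ann s x y.
Proof.
by move=> a0; rewrite /ann -scalerAl => e; apply: (scalerI a0); rewrite e scaler0.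
Qed.

Lemma ann_mull s x y z : ann s x y -> ann s x (z * y).
Proof. by rewrite /ann -mulrA => ->; rewrite mulr0. Qed.

Lemma annB s x y z : ann s x y -> ann s x z -> ann s x (y - z).
Proof. by rewrite /ann mulrBl => -> ->; rewrite subrr. Qed.

(** As 1 + q is invertible, 1 is a combination of T_m + 1 and T_m - q, on which T_m acts by q and
    -1. Then [ann_step] shifts the exponents by 1 and -1, so the lower bound drops by one at each
    step. *)
Lemma ann1_L m : (0 < m <= n)%N ->
  exists2 s, all (fun c => 1 - m%:Z <= c) s & ann s (L m) 1.
Proof.
elim: m => // -[|m] IH mn.
  by exists [:: 0]; rewrite // /ann /qpol big_seq1 /= expr0z scale1r subrr mulr0.
have {IH}[|s /allP hs hy] := IH _; first by lia.
pose s1 := s ++ map (fun c => c + 1) s; pose s2 := s ++ map (fun c => c + -1) s.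
exists (s1 ++ s2).
  apply/allP => c; rewrite !mem_cat => /orP[] /orP[] => [/hs|/mapP[c' /hs h ->]|/hs|/mapP[c' /hs h ->]]; lia.
have hT : (0 < m.+1 < n)%N by lia.
have aux y : ann s (L m.+1) y by rewrite -[y]mulr1; apply: ann_mull.
apply: (ann_scale q2).
have -> : (1 + q)%:A = (T m.+1 + 1) - (T m.+1 - q%:A) :> A.
  by rewrite opprB [RHS](AC (2*2) ((2*3)*(1*4))) /= subrr addr0 scalerDl scale1r.
have quad := hecke_quad relT hT.
apply: annB; [apply: ann_catl | apply: ann_catr].
  apply: (@ann_step m.+1 s q 1) => //; rewrite ?expr1z; try by rewrite addrAC subrr add0r ?mulr1 // oner_eq0.
  by rewrite mulrDl mul1r quad scalerBl scale1r addrAC subrK scalerDr addrC.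
apply: (@ann_step m.+1 s (-1) (-1)) => //.
- by rewrite addNr sub0r oppr_eq0.
- by rewrite addNr sub0r mulrN exprN1 mulVf.
rewrite mulrBl quad -scalerAl mul1r scalerBl scale1r scaleN1r opprB.
by rewrite [LHS](AC (2*1*1) ((1*4)*(3*2))) /= subrr add0r addrC.
Qed.

Lemma ann_L m y : (0 < m <= n)%N ->
  exists2 s, all (fun c => 1 - m%:Z <= c) s & ann s (L m) y.
Proof.
move=> /ann1_L[s hs h]; exists s => //.
by rewrite -[y]mulr1; apply: ann_mull.
Qed.

(* On vectors fixed by the q-symmetrizer of the letters m + 1, ..., n, the
   spectrum of L_j only grows upwards with j. *)
Lemma ann_L_symm m j y : (m < j <= n)%N ->
  (forall i, (m < i < n)%N -> y * T i = q *: y) ->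
  exists2 s, all (fun c => - m%:Z <= c) s & ann s (L j) y.
Proof.
move=> mj hy; elim: j mj => // j IH mj.
(* The first element is L_(m+1), whose general bound is 1 - (m + 1) = -m. *)
have [ej|nej] := eqVneq m j.
  have [|s hs h] := @ann_L j.+1 y; first by lia.
  by exists s => //; apply: sub_all hs => c; lia.
have {IH}[|s /allP hs hs'] := IH _; first by lia.
exists (s ++ map (fun c => c + 1) s).
  by apply/allP => c; rewrite mem_cat => /orP[/hs //|/mapP[c' /hs h ->]]; lia.
apply: (ann_step (t := q)) hs'; rewrite ?expr1z; try lia.
- by rewrite addrAC subrr add0r oner_eq0.
- by rewrite addrAC subrr add0r mulr1.
- by apply: hy; lia.
Qed.

Definition good x y := exists ps : seq {poly nat},
  y * \prod_(p <- ps) (x - (nat_eval q p)%:A) = 0.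

Lemma good_ann (C : A -> Prop) x l s y : GRing.comm x l ->
  (forall z a, C z -> C (z * (l - a%:A))) -> (forall z a, C z -> C (z * (x - a%:A))) ->
  (forall c z, c \in s -> C z -> z * l = q ^ c *: z -> good x z) ->
  C y -> ann s l y -> good x y.
Proof.
move=> cxl Cl Cx; elim: s y => [|c s IH] y H Cy; rewrite /ann.
  by rewrite /qpol big_nil => e; exists [::]; rewrite big_nil.
rewrite qpol_cons mulrA => /IH[||ps e].
- by move=> c' z hc; apply: H; rewrite inE hc orbT.
- exact: Cl.
set z := y * \prod_(p <- ps) (x - (nat_eval q p)%:A).
have [|||ps' e'] := H c z; rewrite ?mem_head //.
- rewrite {}/z; elim: ps y Cy {H IH e} => [|p ps IH] y Cy.
    by rewrite big_nil mulr1.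
  by rewrite big_cons mulrA; apply: IH; apply: Cx.
- apply/eqP; rewrite -subr_eq0 -mulr_algr -mulrBr /z -mulrA.
  rewrite -(_ : GRing.comm (l - (q ^ c)%:A) _) ?mulrA ?e //.
  elim/big_rec: _ => [|p F _ IH']; first exact: commr1.
  apply: commrM => //; apply: commrB; last exact: scalar_comm.
  by apply/commr_sym/commrB => //; apply: scalar_comm.
- by exists (ps ++ ps'); rewrite big_cat mulrA.
Qed.

(** * Moving R_(m,k) through products of B* *)

Definition Rnk m k : A := (\prod_(i < k) qnum i.+1)^-1 *: P m k.

Lemma Rnk0 m : Rnk m 0 = 1.
Proof. by rewrite /Rnk big_ord0 invr1 scale1r P_0. Qed.

Lemma Rnk_rec m k : (m < n)%N -> Rnk m.+1 k.+1 * Bs m.+1 =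
  Bs m.+1 * (q ^+ k.+1 *: Rnk m k.+1 + JM (m.+1 - k) m.+1 * Rnk m k).
Proof.
move=> mn; have := P_rec relT q0 q1 k mn; rewrite /Rnk big_ord_recr /=.
set f := \prod_(i < k) _ => e.
have qk : qnum k.+1 != 0 by [].
rewrite -scalerAl e scalerAr; congr (_ * _).
rewrite scalerDr -!scalerAr !scalerA invfM; congr (_ *: _ + _ *: _).
  by rewrite mulrC.
by rewrite mulfVK.
Qed.

Lemma Bnks_rcons m k : (k <= m)%N -> Bnks m k.+1 = Bnks m k * Bs (m - k).
Proof.
elim: k m => [|k IH] m km; first by rewrite /= mulr1 mul1r subn0.
case: m km => // m km.
by rewrite -[Bnks m.+1 k.+2]/(Bs m.+1 * Bnks m k.+1) IH // mulrA.
Qed.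

Lemma parab_Bnks m k : parab T m (Bnks m k).
Proof.
elim: k m => [|k IH] m /=; first exact: parab1.
by apply: parabM; [exact: parab_Bs | apply: parabW _ (IH _); lia].
Qed.

Section Chain.
Variable m : nat.

(* E d k is the action of R_(m+d, k) on the multiples u B*_(m+d) ... B*_(m+1)
   that are annihilated by B*_m. *)
Fixpoint E d k : A :=
  match d, k with
  | _, 0 => 1
  | 0, _.+1 => 0
  | d'.+1, k'.+1 =>
    q ^+ k *: E d' k + JM ((m + d').+1 - k') (m + d').+1 * E d' k'
  end.

Lemma E_gt d k : (d < k)%N -> E d k = 0.
Proof.
elim: d k => [|d IH] [|k] // dk /=.
by rewrite IH ?(IH k) ?scaler0 ?mulr0 ?addr0 //; lia.
Qed.

Lemma E_comm d k x : (forall j, (m < j <= m + d)%N -> GRing.comm x (L j)) ->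
  GRing.comm x (E d k).
Proof.
elim: d k => [|d IH] [|k] hx; try exact: commr1; first exact: commr0.
have {}IH k' : GRing.comm x (E d k') by apply: IH => j hj; apply: hx; lia.
rewrite /=; apply: commrD.
  exact: commrZ.
by apply: commrM => //; apply/commr_sym/JM_comm/commr_sym/hx; lia.
Qed.

(** Induction on d through [Rnk_rec], with [u * Bs (m + d).+1] in place of [u]. At d = 0,
    [Rnk m k.+1] begins with [Bs m], which is killed by [u]. *)
Lemma Rnk_Bnks d k u : (m + d <= n)%N -> u * Bnks (m + d) d * Bs m = 0 ->
  u * Rnk (m + d) k * Bnks (m + d) d = u * Bnks (m + d) d * E d k.
Proof.
elim: d k u => [|d IH] [|k] u mdn; rewrite ?Rnk0 ?mulr1 //.
  rewrite addn0 /= mulr0 => uB.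
  rewrite /Rnk -scalerAr /P; case: (m) uB => [|m'] uB /=.
    by rewrite !mul0r mulr0 scaler0.
  by rewrite !mulrA uB !mul0r scaler0.
rewrite addnS -[Bnks _ _]/(Bs (m + d).+1 * Bnks (m + d) d) => h.
set X := Bnks (m + d) d in h *; set b := Bs (m + d).+1 in h *.
have mdn' : (m + d < n)%N by lia.
have {}IH k' : (u * b) * Rnk (m + d) k' * X = (u * b) * X * E d k'.
  by apply: IH; [lia | rewrite -(mulrA u)].
have cJ x : parab T (m + d) x -> GRing.comm (JM ((m + d).+1 - k) (m + d).+1) x.
  by move=> hx; apply/JM_comm/(L_comm_parab relT).
have cR : GRing.comm (JM ((m + d).+1 - k) (m + d).+1) (Rnk (m + d) k).
  exact/commrZ/cJ/parab_P.
have cX : GRing.comm (JM ((m + d).+1 - k) (m + d).+1) X by apply/cJ/parab_Bnks.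
rewrite mulrA -(mulrA u) Rnk_rec // -/b cR mulrA [in RHS]mulrA.
rewrite -[E d.+1 k.+1]/(q ^+ k.+1 *: E d k.+1 + JM ((m + d).+1 - k) (m + d).+1 * E d k).
have cE : GRing.comm (JM ((m + d).+1 - k) (m + d).+1) (E d k).
  by apply/E_comm => j hj; apply/JM_comm/(L_comm relT); lia.
move: (JM _ _) (Rnk (m + d)) (E d) IH cR cX cE => J R0 E0 IH cR cX cE.
clearbody X b.
rewrite !(mulrDr (u * b)) (mulrDr (u * b * X)) mulrDl; congr (_ + _).
  by rewrite -!scalerAr -scalerAl IH.
by rewrite (mulrA (u * b)) -(mulrA _ J X) cX mulrA IH cE -!mulrA.
Qed.

Lemma E_eigen d k y :
  (forall j, (m < j <= m + d)%N ->
    exists2 c : int, - m%:Z <= c & y * L j = q ^ c *: y) ->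
  exists p, y * E d k = nat_eval q p *: y.
Proof.
move=> hy; suff [a [p ->] e] : exists2 a, nat_poly q a & y * E d k = a *: y.
  by exists p.
elim: d k hy => [|d IH] [|k] hy.
- by exists 1; [exact: nat_poly1 | rewrite mulr1 scale1r].
- by exists 0; [exact: nat_poly0 | rewrite mulr0 scale0r].
- by exists 1; [exact: nat_poly1 | rewrite mulr1 scale1r].
have {}IH k' : exists2 a, nat_poly q a & y * E d k' = a *: y.
  by apply: IH => j hj; apply: hy; lia.
rewrite /=; have [a1 na1 e1] := IH k.+1; have [a0 na0 e0] := IH k.
(* For k > d the exponent below could be negative, but then [E d k] is 0. *)
have [kd|dk] := leqP k d; last first.
  exists (q ^+ k.+1 * a1); first by apply: nat_polyM => //; apply: nat_polyXn.
  by rewrite (E_gt dk) mulr0 addr0 -scalerAr e1 scalerA.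
have [c hc yL] := hy (m + d).+1 ltac:(lia).
(* Nonnegative because c >= -m and k <= d; the eigenvalue of [JM] is then the q-integer [l]_q. *)
have [l hl] : exists l : nat, ((m + d).+1 - k)%:Z + c = l%:Z.
  by exists (absz (((m + d).+1 - k)%:Z + c)); lia.
exists (q ^+ k.+1 * a1 + qnum l * a0).
  apply: nat_polyD; apply: nat_polyM => //; first exact: nat_polyXn.
  exact: nat_poly_qnum.
rewrite mulrDr -scalerAr e1 scalerA scalerDl; congr (_ + _).
rewrite mulrA (_ : y * JM _ _ = qnum l *: y); first by rewrite -scalerAl e0 scalerA.
rewrite /JM -scalerAr mulrBr mulr1 -scalerAr yL scalerA.
rewrite (_ : q ^+ _ * q ^ c = q ^+ l); last by rewrite exprnP -expfzDr // hl.
rewrite -[X in _ *: (_ - X)]scale1r -scalerBl scalerA.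
by congr (_ *: _); rewrite subrX1 mulKf.
Qed.

Lemma good_E d k y : (m + d <= n)%N -> (forall i, (m < i < n)%N -> y * T i = q *: y) ->
  good (E d k) y.
Proof.
move=> mdn hy.
(* [C t z] says that all the L_j have bounded spectrum on z and that the first t of them already act
   by scalars; [good_ann] raises t by one, until a joint eigenvector is reached. *)
pose C t z := (forall j, (m < j <= m + d)%N ->
    exists2 s, all (fun c => - m%:Z <= c) s & ann s (L j) z) /\
  (forall j, (m < j <= m + t)%N ->
    exists2 c : int, - m%:Z <= c & z * L j = q ^ c *: z).
have Cmul t z w a : (t <= d)%N ->
    (forall j, (m < j <= m + d)%N -> GRing.comm w (L j)) ->
    C t z -> C t (z * (w - a%:A)).
  move=> td cw [hz1 hz2]; have {}cw j : (m < j <= m + d)%N -> GRing.comm (L j) (w - a%:A).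
    move=> hj; apply: commrB; last exact: scalar_comm.
    exact/commr_sym/cw.
  split=> j hj.
    have [s hs e] := hz1 j hj; exists s => //.
    by rewrite /ann -mulrA (qpol_comm s) ?mulrA ?e ?mul0r //; apply/commr_sym/cw.
  have [c hc e] := hz2 j hj; exists c => //.
  by rewrite -mulrA -cw ?mulrA ?e -?scalerAl //; lia.
have cL j j' : (m < j <= m + d)%N -> (m < j' <= m + d)%N -> GRing.comm (L j) (L j').
  by move=> hj hj'; apply: (L_comm relT); lia.
have cE j : (m < j <= m + d)%N -> GRing.comm (L j) (E d k).
  by move=> hj; apply: E_comm => j' hj'; apply: cL.
suff H t z : (t <= d)%N -> C (d - t)%N z -> good (E d k) z.
  apply: (H d) => //; split=> j hj; last by lia.
  by apply: ann_L_symm; first by lia.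
elim: t z => [|t IH] z td Cz.
  have [|p e] := @E_eigen d k z.
    by have [_ h] := Cz; move=> j hj; apply: h; rewrite subn0.
  by exists [:: p]; rewrite big_seq1 mulrBr mulr_algr e subrr.
pose j := (m + (d - t))%N; have hj : (m < j <= m + d)%N by rewrite /j; lia.
have [s /allP hs hz] := Cz.1 j hj.
apply: (@good_ann (C (d - t.+1)%N) _ (L j) s) => //.
- exact/commr_sym/cE.
- by move=> z' a; apply: Cmul => [|j' hj']; [lia | apply: cL].
- by move=> z' a; apply: Cmul => [|j' hj']; [lia | apply/commr_sym/cE].
move=> c z' hc [h1 h2] e; apply: IH; first by lia.
split=> // i hi; have [ei|nei] := eqVneq i j.
  by exists c; [apply: hs | rewrite ei].
by apply: h2; move: nei; rewrite /j; lia.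
Qed.

End Chain.

(** Induction on the number d of factors B* that suffice to kill [u]: multiplying [u] by suitable
    factors [Rnk n k] - p(q) lowers d by one. At d = n + 1 the product contains B*_0 = 0, so every
    [u] qualifies. *)
Theorem Rnk_good k u : good (Rnk n k) u.
Proof.
suff H d : (d <= n.+1)%N -> forall u, u * Bnks n d = 0 -> good (Rnk n k) u.
  apply: (H n.+1) => //; rewrite Bnks_rcons // subnn /= !mulr0 //.
elim: d => [|d IH] dn {}u; first by rewrite mulr1 => ->; exists [::]; rewrite mul0r.
have {}IH := IH (ltnW dn); pose m := (n - d)%N.
have mdn : (m + d = n)%N by rewrite /m; lia.
rewrite Bnks_rcons // -/m mulrA => uB.
have [ps e] : good (E m d k) (u * Bnks n d).
  apply: good_E => [|i hi]; first by rewrite mdn.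
  by rewrite -mulrA (Bnks_symm relT) ?scalerAr //; rewrite /m in hi; lia.
(* Keeps the annihilation by [Bs m] while factors [E m d k] - p(q) are multiplied in. *)
have cB : GRing.comm (Bs m) (E m d k).
  apply: E_comm => j hj; apply/commr_sym.
  case: j hj => // j hj; apply: (L_comm_parab relT q0); first by lia.
  by apply: (parabW _ (@parab_Bs _ _ T m)); lia.
have [ps' e'] : good (Rnk n k) (u * \prod_(p <- ps) (Rnk n k - (nat_eval q p)%:A)).
  apply: IH; rewrite -[RHS]e; elim: ps u uB {e} => [|p ps IH] u uB.
    by rewrite !big_nil !mulr1.
  have h : u * (Rnk n k - (nat_eval q p)%:A) * Bnks n d =
           u * Bnks n d * (E m d k - (nat_eval q p)%:A).
    rewrite !mulrBr mulrBl !mulr_algr -scalerAl; congr (_ - _).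
    by have := @Rnk_Bnks m d k u; rewrite mdn; apply.
  rewrite !big_cons !mulrA IH ?h //.
  rewrite -mulrA -(_ : GRing.comm (Bs m) _) ?mulrA ?uB ?mul0r //.
  by apply: commrB => //; apply: scalar_comm.
by exists (ps ++ ps'); rewrite big_cat mulrA.
Qed.

End Eigenvalues.

(** * Matrices and specialization *)

Lemma rmorph_nat_eval (R S : comNzRingType) (f : {rmorphism R -> S}) (q : R) p :
  f (nat_eval q p) = nat_eval (f q) p.
Proof.
rewrite /nat_eval -horner_map /= -map_poly_comp; congr (_.[_]).
by apply: eq_map_poly => c /=; rewrite rmorph_nat.
Qed.

(** * Polynomials in a matrix and its characteristic polynomial *)

Section MatrixPoly.
Variables (R : comNzRingType) (d : nat).
Implicit Types (A : 'M[R]_d) (s : seq R).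

(* The product of the A - a over a <- s; d may be 0, which excludes \prod. *)
Definition linprod_mx s A : 'M[R]_d := foldr (fun a M => (A - a%:M) *m M) 1%:M s.

Lemma linprod_mx_act (V : algType R) (b : 'I_d -> V) (h : V) A s i :
  (forall i, b i * h = \sum_j A i j *: b j) ->
  b i * \prod_(a <- s) (h - a%:A) = \sum_j linprod_mx s A i j *: b j.
Proof.
move=> hA; elim: s i => [|a s IH] i.
  rewrite big_nil mulr1 (bigD1 i) //= mxE eqxx scale1r big1 ?addr0 // => j ji.
  by rewrite mxE eq_sym (negPf ji) scale0r.
rewrite big_cons mulrA mulrBr mulr_algr hA.
have -> : a *: b i = \sum_j (a%:M : 'M[R]_d) i j *: b j.
  rewrite (bigD1 i) //= mxE eqxx mulr1n big1 ?addr0 // => j ji.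
  by rewrite mxE eq_sym (negPf ji) scale0r.
rewrite -sumrB (eq_bigr (fun j => (A - a%:M) i j *: b j)) => [|j _]; last first.
  by rewrite -scalerBl !mxE.
rewrite mulr_suml (eq_bigr (fun j => \sum_k ((A - a%:M) i j * linprod_mx s A j k) *: b k)).
  rewrite exchange_big; apply: eq_bigr => k _ /=; rewrite mxE scaler_suml.
  by apply: eq_bigr.
by move=> j _; rewrite -scalerAl IH scaler_sumr; apply: eq_bigr => k _; rewrite scalerA.
Qed.

(** The factor theorem for f(x) - f(A), where f is the product of the x - a; each step writes x - a
    as (x - A) + (A - a). *)
Lemma char_poly_linprod A s : exists Q : 'M[{poly R}]_d,
  (\prod_(a <- s) ('X - a%:P))%:M - map_mx polyC (linprod_mx s A) =
  Q *m char_poly_mx A.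
Proof.
elim: s => [|a s [Q IH]].
  by exists 0; rewrite big_nil /= map_mx1 subrr mul0mx.
set f := \prod_(a <- s) _ in IH; set M := linprod_mx s A in IH.
exists (f%:M + map_mx polyC (A - a%:M) *m Q).
have eX : char_poly_mx A + map_mx polyC (A - a%:M) = ('X - a%:P)%:M.
  by rewrite /char_poly_mx map_mxB map_scalar_mx addrA subrK -raddfB.
rewrite mulmxDl -mulmxA -IH big_cons -/f /= map_mxM -/M mulrC scalar_mxM -eX.
rewrite (mulmxDr f%:M) (mulmxBr _ f%:M) addrA; congr (_ + _ - _).
by rewrite -scalar_mxC.
Qed.

End MatrixPoly.

Lemma map_linprod_mx (R S : comNzRingType) (f : {rmorphism R -> S}) d s (A : 'M[R]_d) :
  map_mx f (linprod_mx s A) = linprod_mx (map f s) (map_mx f A).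
Proof.
elim: s => [|a s IH] /=; first exact: map_mx1.
by rewrite map_mxM IH map_mxB map_scalar_mx.
Qed.

Lemma splits_linprod (F : fieldType) (q : F) d (A : 'M[F]_d) (ps : seq {poly nat}) :
  linprod_mx (map (nat_eval q) ps) A = 0 -> splits_nat_poly q (char_poly A).
Proof.
move=> A0; have [Q] := char_poly_linprod A (map (nat_eval q) ps).
rewrite A0 map_mx0 subr0 => /(congr1 determinant).
rewrite det_scalar det_mulmx -/(char_poly A) big_map => e.
(* Repeating the list d times presents f^d, the determinant of the scalar matrix f, as a product of
   linear factors; a monic divisor is a subproduct. *)
have : char_poly A %| \prod_(p <- flatten (nseq d ps)) ('X - (nat_eval q p)%:P).
  by rewrite big_flatten big_nseq iter_mulr mulr1 e dvdp_mull.
case/dvdp_prod_XsubC => m; rewrite eqp_monic ?char_poly_monic ?monic_prod_XsubC //.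
by move=> /eqP ->; exists (mask m (flatten (nseq d ps))).
Qed.

(** * Change of coefficients in the Hecke algebra *)

Section HeckeMap.
Variables (R S : comNzRingType) (f : {rmorphism R -> S}) (n : nat) (q : R) (q' : S).
Hypothesis fq : f q = q'.

(** Covers both the embedding into the fraction field and [specialize], which is the case of
    [horner_eval q]. *)
Definition hecke_map (h : hecke n q) : hecke n q' :=
  [ffun w : 'S_n => f (coefT h w) : S^o].

Lemma coef_hecke_map h w : coefT (hecke_map h) w = f (coefT h w).
Proof. by rewrite /hecke_map {1}/coefT ffunE. Qed.

Lemma hecke_map_is_additive : additive hecke_map.
Proof.
move=> x y; apply: coefT_eq => w.
by rewrite coef_hecke_map /coefT !ffunE rmorphB.
Qed.
HB.instance Definition _ := GRing.isZmodMorphism.Build (hecke n q) (hecke n q')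
  hecke_map hecke_map_is_additive.

Lemma hecke_mapZ a h : hecke_map (a *: h) = f a *: hecke_map h.
Proof. by apply: coefT_eq => w; rewrite coef_hecke_map !coefTZ rmorphM coef_hecke_map. Qed.

Lemma hecke_mapT w : hecke_map (T q w) = T q' w.
Proof. by apply: coefT_eq => u; rewrite coef_hecke_map !coefTE rmorph_nat. Qed.

Lemma hecke_mapM_gen x i : hecke_map (x * gen n q i) = hecke_map x * gen n q' i.
Proof.
have [vi|/s_out e] := boolP ((0 < i)%N && (i < n)%N); last first.
  by rewrite /gen e !mulr1.
rewrite !mul_gen // /lin_ext raddf_sum; apply: eq_bigr => w _ /=.
rewrite hecke_mapZ coef_hecke_map; congr (_ *: _); rewrite /mulTi.
by case: ifP => _; rewrite ?raddfD /= ?hecke_mapZ !hecke_mapT // rmorphB rmorph1 fq.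
Qed.

(** Expanding [y] in the T_w, and T_w along a reduced word, leaves right multiplication by a single
    generator. *)
Lemma hecke_mapM x y : hecke_map (x * y) = hecke_map x * hecke_map y.
Proof.
rewrite {1}(hecke_sumT y) [X in _ = _ * X](hecke_sumT (hecke_map y)) !mulr_sumr raddf_sum.
apply: eq_bigr => w _ /=; rewrite -!scalerAr hecke_mapZ coef_hecke_map; congr (_ *: _).
rewrite !T_redword; elim/last_ind: (redword w) => [|s i IH].
  by rewrite !big_nil !mulr1.
by rewrite -cats1 !big_cat !big_seq1 /= !mulrA hecke_mapM_gen IH.
Qed.

Lemma hecke_map1 : hecke_map 1 = 1.
Proof. exact: hecke_mapT. Qed.

Lemma hecke_map_linprod (I : Type) (s : seq I) (a : I -> R) h :
  hecke_map (\prod_(i <- s) (h - (a i)%:A)) =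
  \prod_(i <- s) (hecke_map h - (f (a i))%:A).
Proof.
elim: s => [|i s IH]; first by rewrite !big_nil hecke_map1.
by rewrite !big_cons hecke_mapM IH raddfB /= hecke_mapZ hecke_map1.
Qed.

End HeckeMap.

(** * The elements of the statement in recursive form *)

Section HeckeElements.
Variables (R : comNzRingType) (n : nat) (q : R).

Lemma hecke_rel_gen : @hecke_rel R (hecke n q) q n (gen n q).
Proof.
split=> [i hi|i i0 hi|i j i0 ij jn]; first exact: gen_sqr.
  by apply: gen_braid; lia.
by apply: gen_comm; lia.
Qed.

Lemma Bel_B m : Bel n q m = @B R (hecke n q) (gen n q) m.
Proof.
elim: m => [|m IH] /=; first by rewrite /Bel big_geq.
rewrite /Bel big_nat_recr //= subnn [X in _ + X]big_geq // addrC; congr (_ + _).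
rewrite -IH /Bel mulr_sumr big_nat [RHS]big_nat; apply: eq_bigr => i /andP[_ im].
rewrite subSn // big_nat_recl //= subn0; congr (_ * _).
by apply: eq_bigr => j _; congr (gen _ _ _); lia.
Qed.

Lemma Bel_star_Bs m : Bel_star n q m = @Bs R (hecke n q) (gen n q) m.
Proof.
elim: m => [|m IH] /=; first by rewrite /Bel_star big_geq.
rewrite /Bel_star big_nat_recr //= [X in _ + X]big_geq // addrC; congr (_ + _).
rewrite -IH /Bel_star mulr_suml big_nat [RHS]big_nat; apply: eq_bigr => i /andP[_ im].
by rewrite big_nat_recr.
Qed.

Lemma Belnk_Bnk k : Belnk n q k = @Bnk R (hecke n q) (gen n q) n k.
Proof.
(* The starting index varies in the induction while the algebra H_n stays fixed. *)
suff H m : \prod_(j < k) Bel n q (m - rev_ord j) = @Bnk R (hecke n q) (gen n q) m k.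
  exact: H.
elim: k m => [|k IH] m; first by rewrite big_ord0.
rewrite big_ord_recr /= -IH !subSS subnn subn0 Bel_B; congr (_ * _).
apply: eq_bigr => j _; congr (Bel _ _ _); have := ltn_ord j; rewrite /=; lia.
Qed.

Lemma Belnk_star_Bnks k : Belnk_star n q k = @Bnks R (hecke n q) (gen n q) n k.
Proof.
suff H m : \prod_(j < k) Bel_star n q (m - j) = @Bnks R (hecke n q) (gen n q) m k.
  exact: H.
elim: k m => [|k IH] m; first by rewrite big_ord0.
rewrite big_ord_recl /= -IH subn0 Bel_star_Bs; congr (_ * _).
by apply: eq_bigr => j _; congr (Bel_star _ _ _); rewrite /bump /=; lia.
Qed.

End HeckeElements.

Lemma hecke_map_B (R S : comNzRingType) (f : {rmorphism R -> S}) n q q' (fq : f q = q') m k :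
  hecke_map f q' (P (gen n q) m k : hecke n q) = P (gen n q') m k.
Proof.
have hg i : hecke_map f q' (gen n q i) = gen n q' i by apply: hecke_mapT.
have hB j : hecke_map f q' (B (gen n q) j) = B (gen n q') j.
  elim: j => [|j IH] /=; first exact: raddf0.
  by rewrite raddfD /= (hecke_mapM fq) hg IH hecke_map1.
have hBs j : hecke_map f q' (Bs (gen n q) j) = Bs (gen n q') j.
  elim: j => [|j IH] /=; first exact: raddf0.
  by rewrite raddfD /= (hecke_mapM fq) hg IH hecke_map1.
rewrite /P (hecke_mapM fq); congr (_ * _).
  elim: k m => [|k IH] m /=; first exact: hecke_map1.
  by rewrite (hecke_mapM fq) hBs IH.
elim: k m => [|k IH] m /=; first exact: hecke_map1.
by rewrite (hecke_mapM fq) hB IH.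
Qed.

(** * From the generic element to the modules over the field *)

Section Main.
Variables (F : fieldType) (n k : nat).
Local Notation X := ('X : {poly F}).

Lemma qnumX_neq0 j : qnum X j.+1 != 0.
Proof.
apply/eqP => /(congr1 (horner^~ 0)); rewrite qnumSl hornerD hornerM hornerX mul0r.
by rewrite addr0 hornerC horner0; apply/eqP; rewrite oner_eq0.
Qed.

(** [P_shuf] over [{poly F}] exhibits the quotient, so that the Euclidean division in [R2R_generic]
    is exact. *)
Lemma R2R_genericP : P (gen n X) n k = qfact X k *: (R2R_generic F n k : hecke n X).
Proof.
have qf0 : qfact X k != 0 by apply/prodf_neq0 => i _; apply: qnumX_neq0.
have [Z e] : exists Z : hecke n X, P (gen n X) n k = qfact X k *: Z.
  have [kn|nk] := leqP k n; last by exists 0; rewrite scaler0 P_gt.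
  by exists (shuf (gen n X) (n - k) k * Bnk (gen n X) n k); apply: (P_shuf (hecke_rel_gen n X)).
rewrite e; congr (_ *: _); apply: coefT_eq => w.
rewrite [RHS]/coefT ffunE Belnk_star_Bnks Belnk_Bnk -/(P _ _ _) e coefTZ.
by rewrite mulrC mulpK.
Qed.

Lemma R2R_generic_killed : exists ps : seq {poly nat},
  \prod_(p <- ps) ((R2R_generic F n k : hecke n X) - (nat_eval X p)%:A) = 0.
Proof.
pose f : {rmorphism {poly F} -> {fraction {poly F}}} := @tofrac {poly F}.
have f0 p : p != 0 -> f p != 0 by rewrite /f /= tofrac_eq0.
(* In the fraction field X, X - 1, 1 + X and the q-integers are nonzero in every characteristic.
   Taking u = 1 makes the product itself vanish. *)
have [||||ps e] := @Rnk_good _ (hecke n (f X)) (f X) n (gen n (f X))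
    (hecke_rel_gen n (f X)) _ _ _ _ k 1.
- by apply: f0; rewrite polyX_eq0.
- by rewrite -(rmorph1 f) -rmorphB; apply: f0; rewrite -polyC1 polyXsubC_eq0.
- rewrite -(rmorph1 f) -rmorphD; apply: f0.
  by have := qnumX_neq0 1; rewrite qnumSl /qnum big_ord1 mulr1.
- move=> j; rewrite (_ : qnum _ _ = f (qnum X j.+1)); first exact/f0/qnumX_neq0.
  by rewrite rmorph_sum; apply: eq_bigr => i _; rewrite rmorphXn.
exists ps; apply: coefT_eq => w.
have fw : f (coefT (\prod_(p <- ps) ((R2R_generic F n k : hecke n X) - (nat_eval X p)%:A)) w) = 0.
  rewrite -(coef_hecke_map f (f X)) (hecke_map_linprod (erefl (f X))).
  rewrite (_ : hecke_map f (f X) _ = Rnk (f X) (gen n (f X)) n k).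
    under eq_bigr do rewrite rmorph_nat_eval.
    by rewrite mul1r in e; rewrite e /coefT ffunE.
  rewrite /Rnk -(hecke_map_B n (erefl (f X))) R2R_genericP hecke_mapZ scalerA.
  rewrite (_ : \prod_(i < k) _ = f (qfact X k)) ?mulVf ?scale1r //.
    by apply: f0; apply/prodf_neq0 => i _; apply: qnumX_neq0.
  rewrite rmorph_prod; apply: eq_bigr => i _.
  by rewrite rmorph_sum; apply: eq_bigr => j _; rewrite rmorphXn.
apply/eqP; move/eqP: fw; rewrite /f /= tofrac_eq0 => /eqP ->.
by rewrite /coefT ffunE.
Qed.

Variable q : F.

Lemma R2R_killed : exists ps : seq {poly nat},
  \prod_(p <- ps) (R2R n q k - (nat_eval q p)%:A) = 0.
Proof.
have [ps e] := R2R_generic_killed; exists ps.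
have hX : horner_eval q X = q by rewrite /horner_eval hornerX.
have := congr1 (hecke_map (horner_eval q) q) e; rewrite (hecke_map_linprod hX) raddf0.
under eq_bigr do rewrite rmorph_nat_eval /= hX.
by [].
Qed.

Lemma splits_regular (h : hecke n q) (ps : seq {poly nat}) :
  \prod_(p <- ps) (h - (nat_eval q p)%:A) = 0 ->
  splits_nat_poly q (char_poly (rmul_mx h)).
Proof.
move=> e; apply: (splits_linprod (ps := ps)).
have hA (i : 'I_#|{perm 'I_n}|) : T q (enum_val i) * h =
    \sum_j rmul_mx h i j *: T q (enum_val j).
  rewrite {1}(hecke_sumT (T q (enum_val i) * h)).
  rewrite (reindex (fun j : 'I_#|{perm 'I_n}| => enum_val j)) /=.
    by apply: eq_bigr => j _; rewrite mxE.
  exact/onW_bij/enum_val_bij.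
apply/matrixP => i j; have := linprod_mx_act (map (nat_eval q) ps) i hA.
rewrite big_map e mulr0 => /(congr1 (fun x : hecke n q => coefT x (enum_val j))) /=.
rewrite coefT_sum (bigD1 j) //= coefTZ coefTE eqxx mulr1 big1 => [|l lj].
  by rewrite addr0 /coefT ffunE mxE.
by rewrite coefTZ coefTE (inj_eq enum_val_inj) eq_sym (negPf lj) mulr0.
Qed.

(** A right ideal is stable under [W], so each [b i * W] has coordinates, which form [C]. The uses
    are r = 0, and r = X - q before specialization. *)
Lemma ridl_linprod0 (R : comNzRingType) (q' : R) (z h : hecke n q') d (A : 'M[R]_d)
    (s : seq R) (r : R) (W : hecke n q') :
  ridl_rmul_mx z h A -> \prod_(a <- s) (h - a%:A) = r *: W ->
  exists C : 'M[R]_d, linprod_mx s A = r *: C.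
Proof.
move=> [b [bz bfree] hA] e.
have /fin_all_exists[c hc] i : exists c : 'I_d -> R, b i * W = \sum_j c j *: b j.
  have [h0 ->] : exists h0, b i = z * h0.
    apply/bz; exists (fun j => (i == j)%:R); rewrite (bigD1 i) //= eqxx scale1r big1 ?addr0 //.
    by move=> j ji; rewrite eq_sym (negPf ji) scale0r.
  by apply/bz; exists (h0 * W); rewrite mulrA.
exists (\matrix_(i, j) c i j); apply/matrixP => i j; rewrite !mxE; apply/eqP.
rewrite -subr_eq0; apply/eqP; move: j.
apply: bfree; under eq_bigr do rewrite scalerBl -scalerA.
rewrite sumrB -scaler_sumr -hc -(linprod_mx_act s i hA) e scalerAr subrr //.
Qed.

Lemma splits_specht (la : seq nat) (h : hecke n q) (ps : seq {poly nat}) d (A : 'M[F]_d) :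
  \prod_(p <- ps) (h - (nat_eval q p)%:A) = 0 -> specht_mx la h A ->
  splits_nat_poly q (char_poly A).
Proof.
move=> e; rewrite /specht_mx; case: eqP => [_ [A' hA' ->] | _ hA]; last first.
  apply: (splits_linprod (ps := ps)).
  have [|C ->] := ridl_linprod0 (s := map (nat_eval q) ps) (r := 0) (W := 0) hA.
    by rewrite big_map e scaler0.
  by rewrite scale0r.
apply: (splits_linprod (ps := ps)).
have hX : horner_eval q X = q by rewrite /horner_eval hornerX.
pose s := map (fun p => (nat_eval q p)%:P) ps.
pose V := \prod_(a <- s) (lift_const h - a%:A).
(* [lift_const] need not be multiplicative, so [V] may be nonzero; but it specializes to 0 at [q],
   hence is divisible by X - q. *)
have V0 w : root (coefT V w) q.
  rewrite rootE -[_.[q]]/(horner_eval q _) -(coef_hecke_map _ q) /V big_map.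
  rewrite (hecke_map_linprod hX) (_ : hecke_map _ _ _ = h).
    under eq_bigr do rewrite /= /horner_eval hornerC.
    by rewrite e /coefT ffunE.
  apply: coefT_eq => u; rewrite coef_hecke_map (_ : coefT _ u = (coefT h u)%:P).
    by rewrite /= /horner_eval hornerC.
  by rewrite {1}/coefT ffunE.
have [C eC] : exists C, linprod_mx s A' = ('X - q%:P) *: C.
  apply: (ridl_linprod0 (W := [ffun w => (coefT V w %/ ('X - q%:P) : {poly F}^o)]) hA').
  rewrite -/V; apply: coefT_eq => w; rewrite coefTZ [in RHS]/coefT ffunE mulrC divpK //.
  by rewrite dvdp_XsubCl; exact: V0.
rewrite (_ : map _ ps = map (horner_eval q) s); last first.
  by rewrite /s -map_comp; apply: eq_map => p; rewrite /= /horner_eval hornerC.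
rewrite -map_linprod_mx eC; apply/matrixP => i j.
by rewrite !mxE rmorphM /= {1}/horner_eval !hornerE subrr mul0r.
Qed.

End Main.

Theorem theorem5p17 (F : fieldType) (q : F) (n k : nat) :
  splits_nat_poly q (char_poly (rmul_mx (R2R n q k))) /\
  (forall (la : seq nat), is_partition n la ->
     forall (d : nat) (A : 'M[F]_d), specht_mx la (R2R n q k) A ->
       splits_nat_poly q (char_poly A)).
Proof.
have [ps e] := R2R_killed n k q; split; first exact: splits_regular e.
by move=> la _ d A; apply: splits_specht e.
Qed.
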